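(* Let $\mathcal{O}^f$ be the full subcategory of $\mathcal{O}$ consisting of all finite dimensional modules in $\mathcal{O}$. Then $\mathcal{O}^f$ is equivalent to the category $\mathbf{Q}_\infty\text{-}\mathrm{fmod}$ of finite dimensional complex representations of the quiver $\mathbf{Q}_\infty$ with its commutativity relations.
   Context: The Schrödinger algebra $\mathfrak{s}$ is the complex Lie algebra with basis $e,h,f,p,q,z$, with $z$ central and the remaining brackets $[h,e]=2e$, $[e,f]=h$, $[h,f]=-2f$, $[e,q]=p$, $[e,p]=0$, $[h,p]=p$, $[f,p]=q$, $[f,q]=0$, $[h,q]=-q$, $[p,q]=z$. Put $U=U(\mathfrak{s})$, $\mathfrak{h}=\mathbb{C}h\oplus\mathbb{C}z$, $\mathfrak{n}_+=\mathbb{C}e\oplus\mathbb{C}p$. A $U$-module is a weight module if it is the direct sum of its simultaneous eigenspaces for $\mathfrak{h}$. Category $\mathcal{O}$ is the full subcategory of the category of $U$-modules consisting of the finitely generated weight modules $M$ with $\dim U(\mathfrak{n}_+)v<\infty$ for all $v\in M$. The quiver $\mathbf{Q}_\infty$ has vertices $0,1,2,\dots$ and, for each $i\ge0$, an arrow $a:i\to i+1$ and an arrow $b:i+1\to i$, with the commutativity relations $ab=ba$: at each vertex $i\ge1$ the two length-two cycles $i\to i-1\to i$ and $i\to i+1\to i$ coincide, and at the vertex $0$ the cycle $0\to1\to0$ is zero. Objects of $\mathbf{Q}_\infty\text{-}\mathrm{fmod}$ are representations satisfying these relations in which every vertex is represented by a finite dimensional vector space and all but finitely many of these spaces are zero.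 *)

(* Defs.v *)
From HB Require Import structures.
From mathcomp Require Import all_boot all_algebra generic_quotient.
From mathcomp Require Import boolp classical_sets functions cardinality reals.
From mathcomp Require Import ring complex.

Set Implicit Arguments.
Unset Strict Implicit.
Unset Printing Implicit Defensive.

Import GRing.Theory.
Local Open Scope ring_scope.
Local Open Scope classical_set_scope.
Local Open Scope quotient_scope.

Record category := Category {
  Ob :> Type;
  Hom : Ob -> Ob -> Type;
  idc : forall x, Hom x x;
  compc : forall x y z, Hom y z -> Hom x y -> Hom x z;
  comp_idl : forall x y (f : Hom x y), compc (idc y) f = f;
  comp_idr : forall x y (f : Hom x y), compc f (idc x) = f;
  comp_assoc : forall w x y z (f : Hom y z) (g : Hom x y) (h : Hom w x),
    compc f (compc g h) = compc (compc f g) h }.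

Arguments idc {c} x.
Arguments compc {c x y z} f g.

Record functor (C D : category) := Functor {
  fob :> C -> D;
  fmap : forall x y, Hom x y -> Hom (fob x) (fob y);
  fmap_id : forall x, fmap (idc x) = idc (fob x);
  fmap_comp : forall x y z (f : Hom y z) (g : Hom x y),
    fmap (compc f g) = compc (fmap f) (fmap g) }.

Arguments fmap {C D} F {x y} f : rename.

Definition functor_id (C : category) : functor C C :=
  @Functor C C id (fun _ _ f => f) (fun _ => erefl) (fun _ _ _ _ _ => erefl).

Section FunctorComp.
Variables (C D E : category) (G : functor D E) (F : functor C D).

Lemma fmap_id2 x : fmap G (fmap F (idc x)) = idc (G (F x)).
Proof. by rewrite !fmap_id. Qed.

Lemma fmap_comp2 x y z (f : Hom y z) (g : Hom x y) :
  fmap G (fmap F (compc f g)) = compc (fmap G (fmap F f)) (fmap G (fmap F g)).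
Proof. by rewrite !fmap_comp. Qed.

Definition functor_comp : functor C E :=
  @Functor C E (fun x => G (F x)) (fun _ _ f => fmap G (fmap F f))
    fmap_id2 fmap_comp2.
End FunctorComp.

Record nat_iso (C D : category) (F G : functor C D) := NatIso {
  nat_hom : forall x, Hom (F x) (G x);
  nat_inv : forall x, Hom (G x) (F x);
  nat_homK : forall x, compc (nat_inv x) (nat_hom x) = idc (F x);
  nat_invK : forall x, compc (nat_hom x) (nat_inv x) = idc (G x);
  naturality : forall x y (f : Hom x y),
    compc (nat_hom y) (fmap F f) = compc (fmap G f) (nat_hom x) }.

Definition equivalent (C D : category) : Prop :=
  exists (F : functor C D) (G : functor D C),
    inhabited (nat_iso (functor_comp G F) (functor_id C)) /\
    inhabited (nat_iso (functor_comp F G) (functor_id D)).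

Definition full_subcategory (C : category) (P : C -> Prop) : category :=
  @Category {x : C | P x} (fun x y => Hom (sval x) (sval y))
    (fun x => idc (sval x)) (fun _ _ _ f g => compc f g)
    (fun _ _ f => comp_idl f) (fun _ _ f => comp_idr f)
    (fun _ _ _ _ f g h => comp_assoc f g h).

Section ModuleCategory.
Variable A : pzRingType.

Lemma linear_inj (M N : lmodType A) (f g : {linear M -> N}) : f =1 g -> f = g.
Proof.
case: f => f [[fA] [fZ]]; case: g => g [[gA] [gZ]] /= /funext fg.
by subst g; congr (GRing.Linear.Pack (GRing.Linear.Class _ _));
  [congr GRing.isNmodMorphism.Axioms_ | congr GRing.isScalable.Axioms_];
  exact: Prop_irrelevance.
Qed.

Definition lcomp (M N P : lmodType A) (f : {linear N -> P}) (g : {linear M -> N}) :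
  {linear M -> P} := f \o g.
Definition lid (M : lmodType A) : {linear M -> M} := idfun.

Definition module_category : category.
Proof.
refine (@Category (lmodType A) (fun M N => {linear M -> N}) lid lcomp _ _ _).
- by move=> M N f; apply: linear_inj.
- by move=> M N f; apply: linear_inj.
- by move=> L M N P f g h; apply: linear_inj.
Defined.
End ModuleCategory.

Definition lspan (A : pzRingType) (M : lmodType A) (n : nat) (w : 'I_n -> M) :
  set M := [set v | exists c : 'I_n -> A, v = \sum_i c i *: w i].

Definition finitely_generated (A : pzRingType) (M : lmodType A) : Prop :=
  exists n (w : 'I_n -> M), lspan w = setT.

Definition finite_dim (K : fieldType) (V : lmodType K) (W : set V) : Prop :=
  exists n (w : 'I_n -> V), lspan w = W.

(* Internal direct sum decomposition V = \bigoplus_i W i, for subgroups W i. *)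
Definition is_direct_sum (I : choiceType) (V : zmodType) (W : I -> set V) :=
  (forall v, exists (s : seq I) (w : I -> V),
     [/\ uniq s, forall i, W i (w i) & v = \sum_(i <- s) w i]) /\
  (forall (s : seq I) (w : I -> V), uniq s -> (forall i, W i (w i)) ->
     \sum_(i <- s) w i = 0 -> forall i, i \in s -> w i = 0).

(* The K-vector space underlying a module over the K-algebra A. *)
Definition restrict (K : fieldType) (A : lalgType K) (M : lmodType A) : Type :=
  M.

Section Restrict.
Variables (K : fieldType) (A : lalgType K) (M : lmodType A).

HB.instance Definition _ := GRing.Zmodule.on (restrict M).

Definition rscale (c : K) (v : restrict M) : restrict M := c%:A *: (v : M).
Lemma rscaleA a b v : rscale a (rscale b v) = rscale (a * b) v.
Proof. by rewrite /rscale scalerA -scalerAl mul1r scalerA. Qed.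
Lemma rscale1 : left_id 1 rscale.
Proof. by move=> v; rewrite /rscale !scale1r. Qed.
Lemma rscaleDr : right_distributive rscale +%R.
Proof. by move=> a u v; rewrite /rscale scalerDr. Qed.
Lemma rscaleDl v : {morph rscale^~ v : a b / a + b}.
Proof. by move=> a b; rewrite /rscale !scalerDl. Qed.

HB.instance Definition _ := GRing.Zmodule_isLmodule.Build K (restrict M)
  rscaleA rscale1 rscaleDr rscaleDl.
End Restrict.

Definition is_subalgebra (K : fieldType) (A : lalgType K) (B : set A) : Prop :=
  [/\ B 1, forall (c : K) x y, B x -> B y -> B (c *: x + y)
    & forall x y, B x -> B y -> B (x * y)].

Definition subalgebra_generated (K : fieldType) (A : lalgType K) (X : set A) :
  set A := smallest (@is_subalgebra K A) X.

HB.mixin Record Lmodule_isLieAlgebra (K : fieldType) L of GRing.Lmodule K L := {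
  lie : L -> L -> L;
  lie_linearl : forall (c : K) x y z, lie (c *: x + y) z = c *: lie x z + lie y z;
  lie_linearr : forall (c : K) x y z, lie z (c *: x + y) = c *: lie z x + lie z y;
  liexx : forall x, lie x x = 0;
  jacobi : forall x y z,
    lie x (lie y z) + lie y (lie z x) + lie z (lie x y) = 0
}.

#[short(type="lieAlgType")]
HB.structure Definition LieAlgebra (K : fieldType) :=
  {L of GRing.Lmodule K L & Lmodule_isLieAlgebra K L}.

Section Enveloping.
Variables (K : fieldType) (L : lieAlgType K).

(* U(L) is the unital associative K-algebra generated by the vector space L
   subject to x y - y x = [x, y]: formal expressions modulo the least
   congruence imposing the K-algebra axioms, the linearity of L -> U(L) and
   these relations. *)
Inductive uterm :=
  | TGen of L
  | TScal of K
  | TAdd of uterm & uterm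
  | TMul of uterm & uterm.

Inductive uequiv : uterm -> uterm -> Prop :=
  | ueq_refl t : uequiv t t
  | ueq_sym t u : uequiv t u -> uequiv u t
  | ueq_trans t u v : uequiv t u -> uequiv u v -> uequiv t v
  | ueq_add t t' u u' :
      uequiv t t' -> uequiv u u' -> uequiv (TAdd t u) (TAdd t' u')
  | ueq_mul t t' u u' :
      uequiv t t' -> uequiv u u' -> uequiv (TMul t u) (TMul t' u')
  | ueq_addA t u v : uequiv (TAdd t (TAdd u v)) (TAdd (TAdd t u) v)
  | ueq_addC t u : uequiv (TAdd t u) (TAdd u t)
  | ueq_add0 t : uequiv (TAdd (TScal 0) t) t
  | ueq_mulA t u v : uequiv (TMul t (TMul u v)) (TMul (TMul t u) v)
  | ueq_mul1 t : uequiv (TMul (TScal 1) t) t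
  | ueq_mul0 t : uequiv (TMul (TScal 0) t) (TScal 0)
  | ueq_mulDl t u v : uequiv (TMul (TAdd t u) v) (TAdd (TMul t v) (TMul u v))
  | ueq_mulDr t u v : uequiv (TMul t (TAdd u v)) (TAdd (TMul t u) (TMul t v))
  | ueq_scalD a b : uequiv (TScal (a + b)) (TAdd (TScal a) (TScal b))
  | ueq_scalM a b : uequiv (TScal (a * b)) (TMul (TScal a) (TScal b))
  | ueq_scalC a t : uequiv (TMul (TScal a) t) (TMul t (TScal a))
  | ueq_gen a x y :
      uequiv (TGen (a *: x + y)) (TAdd (TMul (TScal a) (TGen x)) (TGen y))
  | ueq_lie x y :
      uequiv (TMul (TGen x) (TGen y))
             (TAdd (TMul (TGen y) (TGen x)) (TGen (lie x y))).

HB.instance Definition _ := gen_eqMixin uterm.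
HB.instance Definition _ := gen_choiceMixin uterm.

Definition ueqb t u := `[< uequiv t u >].
Lemma ueqb_refl : reflexive ueqb.
Proof. by move=> t; apply/asboolP; constructor. Qed.
Lemma ueqb_sym : symmetric ueqb.
Proof. by move=> t u; apply/asboolP/asboolP; apply: ueq_sym. Qed.
Lemma ueqb_trans : transitive ueqb.
Proof.
by move=> u t v /asboolP tu /asboolP uv; apply/asboolP; apply: ueq_trans tu uv.
Qed.

Canonical ueq_equiv := EquivRel ueqb ueqb_refl ueqb_sym ueqb_trans.

Definition uea : Type := {eq_quot ueq_equiv}.

HB.instance Definition _ := Choice.on uea.

Definition uclass (t : uterm) : uea := \pi_({eq_quot ueq_equiv}) t.
Definition urepr (x : uea) : uterm := repr (x : {eq_quot ueq_equiv}).

Lemma uclassP t u : uclass t = uclass u <-> uequiv t u.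
Proof.
split=> [/eqmodP /asboolP //|tu]; apply/eqmodP; exact/asboolP.
Qed.

Lemma ureprK x : uclass (urepr x) = x.
Proof. exact: reprK. Qed.

Lemma urepr_uclass t : uequiv (urepr (uclass t)) t.
Proof. by apply/uclassP; rewrite ureprK. Qed.

Lemma uea_ind (P : uea -> Prop) : (forall t, P (uclass t)) -> forall x, P x.
Proof. by move=> Pt x; rewrite -(ureprK x). Qed.

Definition uadd (x y : uea) : uea := uclass (TAdd (urepr x) (urepr y)).
Definition umul (x y : uea) : uea := uclass (TMul (urepr x) (urepr y)).
Definition uopp (x : uea) : uea := umul (uclass (TScal (-1))) x.
Definition uscale (c : K) (x : uea) : uea := umul (uclass (TScal c)) x.

Lemma uaddE t u : uadd (uclass t) (uclass u) = uclass (TAdd t u).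
Proof. by apply/uclassP/ueq_add; apply: urepr_uclass. Qed.
Lemma umulE t u : umul (uclass t) (uclass u) = uclass (TMul t u).
Proof. by apply/uclassP/ueq_mul; apply: urepr_uclass. Qed.

Lemma uaddA : associative uadd.
Proof.
by elim/uea_ind=> t; elim/uea_ind=> u; elim/uea_ind=> v; rewrite !uaddE;
  apply/uclassP/ueq_addA.
Qed.
Lemma uaddC : commutative uadd.
Proof.
by elim/uea_ind=> t; elim/uea_ind=> u; rewrite !uaddE; apply/uclassP/ueq_addC.
Qed.
Lemma uadd0 : left_id (uclass (TScal 0)) uadd.
Proof. by elim/uea_ind=> t; rewrite !uaddE; apply/uclassP/ueq_add0. Qed.
Lemma umulDl : left_distributive umul uadd.
Proof.
by elim/uea_ind=> t; elim/uea_ind=> u; elim/uea_ind=> v;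
  rewrite !(uaddE, umulE); apply/uclassP/ueq_mulDl.
Qed.
Lemma umulDr : right_distributive umul uadd.
Proof.
by elim/uea_ind=> t; elim/uea_ind=> u; elim/uea_ind=> v;
  rewrite !(uaddE, umulE); apply/uclassP/ueq_mulDr.
Qed.
Lemma umulA : associative umul.
Proof.
by elim/uea_ind=> t; elim/uea_ind=> u; elim/uea_ind=> v; rewrite !umulE;
  apply/uclassP/ueq_mulA.
Qed.
Lemma umul1l : left_id (uclass (TScal 1)) umul.
Proof. by elim/uea_ind=> t; rewrite !umulE; apply/uclassP/ueq_mul1. Qed.
Lemma uscalC c x : umul (uclass (TScal c)) x = umul x (uclass (TScal c)).
Proof. by elim/uea_ind: x => t; rewrite !umulE; apply/uclassP/ueq_scalC. Qed.
Lemma umul1r : right_id (uclass (TScal 1)) umul.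
Proof. by move=> x; rewrite -uscalC umul1l. Qed.
Lemma uscalD a b :
  uclass (TScal (a + b)) = uadd (uclass (TScal a)) (uclass (TScal b)).
Proof. by rewrite uaddE; apply/uclassP/ueq_scalD. Qed.
Lemma uscalM a b :
  uclass (TScal (a * b)) = umul (uclass (TScal a)) (uclass (TScal b)).
Proof. by rewrite umulE; apply/uclassP/ueq_scalM. Qed.
Lemma umul0 x : umul (uclass (TScal 0)) x = uclass (TScal 0).
Proof. by elim/uea_ind: x => t; rewrite !umulE; apply/uclassP/ueq_mul0. Qed.
Lemma uaddN : left_inverse (uclass (TScal 0)) uopp uadd.
Proof.
by move=> x; rewrite /uopp -[X in uadd _ X]umul1l -umulDl -uscalD addNr umul0.
Qed.

HB.instance Definition _ := GRing.isZmodule.Build uea uaddA uaddC uadd0 uaddN.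

(* The augmentation U(L) -> K shows that 1 != 0. *)
Definition uaug := fix aug (t : uterm) : K :=
  match t with
  | TGen _ => 0
  | TScal c => c
  | TAdd t u => aug t + aug u
  | TMul t u => aug t * aug u
  end.

Lemma uaugP t u : uequiv t u -> uaug t = uaug u.
Proof.
by elim=> //= *; try congruence;
  rewrite ?(addrA, add0r, mulrA, mul1r, mul0r, mulr0, addr0, mulrDl, mulrDr) //;
  [exact: addrC | exact: mulrC].
Qed.

Lemma unz : uclass (TScal 1) != 0.
Proof.
by apply/eqP => /uclassP /uaugP /= /eqP; rewrite oner_eq0.
Qed.

HB.instance Definition _ := GRing.Zmodule_isNzRing.Build uea
  umulA umul1l umul1r umulDl umulDr unz.

Lemma uscaleA a b x : uscale a (uscale b x) = uscale (a * b) x.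
Proof. by rewrite /uscale umulA -uscalM. Qed.
Lemma uscale1 : left_id 1 uscale.
Proof. exact: umul1l. Qed.
Lemma uscaleDr : right_distributive uscale +%R.
Proof. by move=> c x y; apply: umulDr. Qed.
Lemma uscaleDl x : {morph uscale^~ x : a b / a + b}.
Proof. by move=> a b; rewrite /uscale uscalD; apply: umulDl. Qed.

HB.instance Definition _ := GRing.Zmodule_isLmodule.Build K uea
  uscaleA uscale1 uscaleDr uscaleDl.

Lemma uscaleAl (c : K) (x y : uea) : c *: (x * y) = (c *: x) * y.
Proof. exact: umulA. Qed.
HB.instance Definition _ := GRing.Lmodule_isLalgebra.Build K uea uscaleAl.

Lemma uscaleAr (c : K) (x y : uea) : c *: (x * y) = x * (c *: y).
Proof.
rewrite [LHS]umulA [X in umul X _ = _]uscalC; symmetry; exact: umulA.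
Qed.
HB.instance Definition _ := GRing.Lalgebra_isAlgebra.Build K uea uscaleAr.

Lemma uclassD t u : uclass (TAdd t u) = uclass t + uclass u.
Proof. by rewrite [RHS]uaddE. Qed.
Lemma uclassM t u : uclass (TMul t u) = uclass t * uclass u.
Proof. by rewrite [RHS]umulE. Qed.
Lemma uclassS c : uclass (TScal c) = c%:A.
Proof. by rewrite -[LHS]umul1r. Qed.

Definition ugen (x : L) : uea := uclass (TGen x).

Lemma ugen_linear : linear ugen.
Proof.
move=> c x y; rewrite -[ugen x]/(uclass _) -[ugen y]/(uclass _).
by rewrite -mulr_algl -uclassS -uclassM -uclassD; apply/uclassP/ueq_gen.
Qed.

Lemma ugen_lie (x y : L) : ugen (lie x y) = ugen x * ugen y - ugen y * ugen x.
Proof.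
apply/eqP; rewrite eq_sym subr_eq; apply/eqP.
by rewrite addrC -!uclassM -uclassD; apply/uclassP/ueq_lie.
Qed.
End Enveloping.

Inductive sbasis := se | sh | sf | sp | sq | sz.

Definition sbasis_pickle (x : sbasis) : nat :=
  match x with se => 0 | sh => 1 | sf => 2 | sp => 3 | sq => 4 | sz => 5 end.
Definition sbasis_unpickle (n : nat) : option sbasis :=
  nth None [:: Some se; Some sh; Some sf; Some sp; Some sq; Some sz] n.
Lemma sbasis_pickleK : pcancel sbasis_pickle sbasis_unpickle.
Proof. by case. Qed.
HB.instance Definition _ :=
  Countable.copy sbasis (pcan_type sbasis_pickleK).
Lemma sbasis_enumP : Finite.axiom [:: se; sh; sf; sp; sq; sz].
Proof. by case. Qed.
HB.instance Definition _ := isFinite.Build sbasis sbasis_enumP.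

Section Schrodinger.
Variable K : fieldType.

Definition schrodinger : Type := {ffun sbasis -> K^o}.
HB.instance Definition _ :=
  GRing.Lmodule.copy schrodinger {ffun sbasis -> K^o}.

Definition svec (x : sbasis) : schrodinger := [ffun y => (y == x)%:R].

(* Each unordered pair of basis vectors is listed in at most one order, so that
   the bracket of basis vectors is [x, y] = slisted x y - slisted y x. *)
Definition slisted (x y : sbasis) : schrodinger :=
  match x, y with
  | sh, se => 2%:R *: svec se
  | se, sf => svec sh
  | sh, sf => - (2%:R *: svec sf)
  | se, sq => svec sp
  | sh, sp => svec sp
  | sf, sp => svec sq
  | sh, sq => - svec sq
  | sp, sq => svec sz
  | _, _ => 0
  end.

Definition sbracket (u v : schrodinger) : schrodinger :=
  \sum_x \sum_y (u x * v y) *: (slisted x y - slisted y x).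

Lemma sum_sbasis (V : nmodType) (f : sbasis -> V) :
  \sum_x f x = f se + (f sh + (f sf + (f sp + (f sq + f sz)))).
Proof.
rewrite (perm_big [:: se; sh; sf; sp; sq; sz]) /=; last first.
  apply: uniq_perm; rewrite ?index_enum_uniq // => x.
  by rewrite mem_index_enum; case: x.
by rewrite !big_cons big_nil addr0.
Qed.

Lemma slistedE x y g : slisted x y g = match g, x, y with
  | se, sh, se => 2%:R
  | sh, se, sf => 1
  | sf, sh, sf => - 2%:R
  | sp, se, sq => 1
  | sp, sh, sp => 1
  | sq, sf, sp => 1
  | sq, sh, sq => - 1
  | sz, sp, sq => 1
  | _, _, _ => 0
  end :> K.
Proof.
by case: g; case: x; case: y; rewrite /= !ffunE //= ?oppr0 // ?scaler0 ?oppr0 //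
  ?[_ *: _]mulr1.
Qed.

Lemma sbracketE u v g : sbracket u v g = match g with
  | se => 2%:R * (u sh * v se - u se * v sh)
  | sh => u se * v sf - u sf * v se
  | sf => - 2%:R * (u sh * v sf - u sf * v sh)
  | sp => u se * v sq - u sq * v se + (u sh * v sp - u sp * v sh)
  | sq => u sf * v sp - u sp * v sf - (u sh * v sq - u sq * v sh)
  | sz => u sp * v sq - u sq * v sp
  end :> K.
Proof.
have -> : sbracket u v g =
    \sum_x \sum_y u x * v y * (slisted x y g - slisted y x g) :> K.
  rewrite sum_ffunE; apply: eq_bigr => x _; rewrite sum_ffunE.
  by apply: eq_bigr => y _; rewrite !ffunE.
rewrite !sum_sbasis !slistedE; case: g;
  move: (u se) (u sh) (u sf) (u sp) (u sq) (u sz);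
  move: (v se) (v sh) (v sf) (v sp) (v sq) (v sz);
  rewrite /GRing.regular /= => *; ring.
Qed.

Lemma sbracket_linearl (c : K) x y z :
  sbracket (c *: x + y) z = c *: sbracket x z + sbracket y z.
Proof.
apply/ffunP => g; rewrite [RHS]ffunE [X in _ = X + _]ffunE !sbracketE.
rewrite !ffunE /GRing.scale /=.
case: g; move: (x se) (x sh) (x sf) (x sp) (x sq) (x sz);
  move: (y se) (y sh) (y sf) (y sp) (y sq) (y sz);
  move: (z se) (z sh) (z sf) (z sp) (z sq) (z sz);
  rewrite /GRing.regular /= => *; ring.
Qed.
Lemma sbracketC x y : sbracket x y = - sbracket y x.
Proof.
apply/ffunP => g; rewrite [RHS]ffunE !sbracketE.
case: g; move: (x se) (x sh) (x sf) (x sp) (x sq) (x sz);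
  move: (y se) (y sh) (y sf) (y sp) (y sq) (y sz);
  rewrite /GRing.regular /= => *; ring.
Qed.
Lemma sbracket_linearr (c : K) x y z :
  sbracket z (c *: x + y) = c *: sbracket z x + sbracket z y.
Proof.
by rewrite sbracketC sbracket_linearl opprD -scalerN -!sbracketC.
Qed.
Lemma sbracketxx x : sbracket x x = 0.
Proof.
apply/ffunP => g; rewrite [RHS]ffunE !sbracketE.
case: g; move: (x se) (x sh) (x sf) (x sp) (x sq) (x sz);
  rewrite /GRing.regular /= => *; ring.
Qed.
Lemma sbracket_jacobi x y z :
  sbracket x (sbracket y z) + sbracket y (sbracket z x)
    + sbracket z (sbracket x y) = 0.
Proof.
apply/ffunP => g; rewrite [RHS]ffunE [LHS]ffunE [X in X + _ = _]ffunE.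
rewrite 3!(sbracketE _ _ g).
case: g; rewrite !sbracketE; move: (x se) (x sh) (x sf) (x sp) (x sq) (x sz);
  move: (y se) (y sh) (y sf) (y sp) (y sq) (y sz);
  move: (z se) (z sh) (z sf) (z sp) (z sq) (z sz);
  rewrite /GRing.regular /= => *; ring.
Qed.

HB.instance Definition _ := Lmodule_isLieAlgebra.Build K schrodinger
  sbracket_linearl sbracket_linearr sbracketxx sbracket_jacobi.

Definition Us : algType K := uea schrodinger.

(* The image of x in U(s). *)
Definition ub (x : sbasis) : Us := ugen (svec x).

(* A weight, i.e. a linear form on Ch + Cz, is given by its values on h, z. *)
Definition weight_space (M : lmodType Us) (lam : K * K) : set M :=
  [set v | ub sh *: v = lam.1%:A *: v /\ ub sz *: v = lam.2%:A *: v].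

Definition weight_module (M : lmodType Us) : Prop :=
  is_direct_sum (@weight_space M).

(* The image of U(n_+) in U(s), for n_+ spanned by e and p. *)
Definition Un_plus : set Us := subalgebra_generated [set ub se; ub sp].

Definition in_category_O (M : lmodType Us) : Prop :=
  [/\ finitely_generated M,
      weight_module M
    & forall v : M,
        finite_dim ([set u *: v | u in Un_plus] : set (restrict M))].

Definition category_O : category :=
  full_subcategory (C := module_category Us) in_category_O.

Definition category_Of : category :=
  full_subcategory (C := category_O)
    (fun M => finite_dim ([set: restrict (sval M)])).
End Schrodinger.

Section Quiver.
Variable K : fieldType.

(* qa i and qb i are the maps of the arrows a : i -> i+1 and b : i+1 -> i;
   q_rel i is the relation at the vertex i+1. *)
Record Qrep := QRep {
  qspace :> nat -> vectType K;
  qa : forall i, 'Hom(qspace i, qspace i.+1);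
  qb : forall i, 'Hom(qspace i.+1, qspace i);
  q_rel0 : (qb 0 \o qa 0)%VF = 0;
  q_rel : forall i, (qa i \o qb i)%VF = (qb i.+1 \o qa i.+1)%VF }.

Record Qhom (V W : Qrep) := QHom {
  qhom :> forall i, 'Hom(V i, W i);
  qhom_a : forall i, (qhom i.+1 \o qa V i)%VF = (qa W i \o qhom i)%VF;
  qhom_b : forall i, (qhom i \o qb V i)%VF = (qb W i \o qhom i.+1)%VF }.

Lemma qhom_inj (V W : Qrep) (f g : Qhom V W) : (forall i, f i = g i) -> f = g.
Proof.
case: f => f fa fb; case: g => g ga gb /= fgi.
have fg : f = g by apply: functional_extensionality_dep.
by subst g; congr QHom; apply: Prop_irrelevance.
Qed.

Definition qid (V : Qrep) : Qhom V V.
Proof. by exists (fun i => \1%VF) => i; rewrite comp_lfun1l comp_lfun1r. Defined.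

Definition qcomp (U V W : Qrep) (f : Qhom V W) (g : Qhom U V) : Qhom U W.
Proof.
exists (fun i => f i \o g i)%VF => i.
- by rewrite -comp_lfunA qhom_a !comp_lfunA qhom_a.
- by rewrite -comp_lfunA qhom_b !comp_lfunA qhom_b.
Defined.

Definition Qrep_category : category.
Proof.
refine (@Category Qrep Qhom qid qcomp _ _ _).
- by move=> V W f; apply: qhom_inj => i; apply: comp_lfun1l.
- by move=> V W f; apply: qhom_inj => i; apply: comp_lfun1r.
- by move=> U V W X f g h; apply: qhom_inj => i; apply: comp_lfunA.
Defined.

Definition Qinf_fmod : category :=
  full_subcategory (C := Qrep_category)
    (fun V => finite_set [set i | \dim {: V i} <> 0%N]).
End Quiver.

(* Main.v *)
(* On a finite-dimensional weight module M the centre z acts by zero: a top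
   vector for p in the z-eigenspace of m satisfies p q^k v = k m q^(k-1) v, so for
   m <> 0 no q^k v would vanish.  Hence M is a module over sl_2 acting on an
   abelian ideal spanned by p and q.  Let M_n be the space of vectors of h-weight n
   killed by e.  Then p maps M_n to M_(n+1), the operator (n+2) q - f p maps
   M_(n+1) to M_n, and these two commute exactly, which gives a representation of
   the quiver.  Conversely, a representation V of the quiver gives the module of
   sums of g_(n,k) x^(n-k) y^k with g_(n,k) in V_n and k <= n, on which
     e = x d/dy, f = y d/dx, h = x d/dx - y d/dy, p = x a + d/dy b', q = y a - d/dx b'
   where b' is -1/(n(n+1)) times b on V_n; the quiver relations are what makes p
   and q commute.  The map sending x^(n-k) y^k v to (n-k)!/n! f^k v is a natural
   isomorphism onto M; its surjectivity is complete reducibility under sl_2. *)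
Require Import Defs.
From HB Require Import structures.
From mathcomp Require Import all_boot all_order all_algebra reals complex.
From mathcomp Require Import boolp classical_sets functions cardinality.
From mathcomp Require Import ring.

Set Implicit Arguments.
Unset Strict Implicit.
Unset Printing Implicit Defensive.

Import Order.TTheory GRing.Theory Num.Theory VectorInternalTheory.
Local Open Scope ring_scope.

(** * Finite-dimensional spaces without a chosen basis *)

(** The formulas for p and q come from Clebsch-Gordan. Once z = 0, p and q span a copy of the
    two-dimensional sl_2-module Sym^1, and Sym^1 tensor Sym^n splits as Sym^(n+1) plus Sym^(n-1),
    the two projections being multiplication by x, y and the derivations d/dy, -d/dx. An equivariant
    action of (p, q) on the sum of the V_n tensor Sym^n therefore amounts to one map a up and one
    map b' down between the V_n, and expanding [p, q] leaves the single condition (n+2) b'a = n ab'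
    on V_n. On x^n v the operator (n+1) q - f p gives -n(n+1) x^(n-1) b'v; this is the origin of the
    factor -1/(n(n+1)). Two scalar rings act on one carrier: morphisms are linear over U(s), while
    dimensions, eigenvalues and bases belong to the field. The aliases [restrict], [fdvect] and
    [repmod] switch between the two without changing the vectors. *)

Section FiniteDimension.
Variable K : fieldType.

Definition subspace (V : lmodType K) (W : set V) : Prop :=
  W 0 /\ forall c u v, W u -> W v -> W (c *: u + v).

(** Among the [{vspace X}] contained in [W], one of maximal dimension is all of [W]: adjoining the
    line of a further vector of [W] would stay inside [W]. *)
Lemma subspace_vspace (X : vectType K) (W : set X) :
  subspace W -> exists S : {vspace X}, forall v, v \in S <-> W v.
Proof.
move=> [W0 Wlin].
pose P d := `[< exists2 S : {vspace X}, forall v, v \in S -> W v & \dim S = d >].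
have exP : exists d, P d.
  exists 0%N; apply/asboolP; exists 0%VS; last by rewrite dimv0.
  by move=> v; rewrite memv0 => /eqP ->.
have ubP d : P d -> (d <= \dim {:X})%N.
  by move=> /asboolP [S _ <-]; apply: dimvS; apply: subvf.
case: (ex_maxnP exP ubP) => d /asboolP [S SW dimS] maxd.
exists S => v; split=> [/SW //|Wv].
have : P (\dim (S + <[v]>)%VS).
  apply/asboolP; exists (S + <[v]>)%VS => // w /memv_addP [s Ss [t /vlineP [c ->] ->]].
  by rewrite addrC; apply: Wlin => //; apply: SW.
move=> /maxd; rewrite -dimS => le_dim.
have : (S == S + <[v]>)%VS by rewrite eqEdim addvSl le_dim.
by move=> /eqP ->; rewrite memvE addvSr.
Qed.

Lemma finite_dim_family (V : lmodType K) (T : finType) (w : T -> V) (W : set V) :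
  (forall v, W v <-> exists c : T -> K, v = \sum_t c t *: w t) -> finite_dim W.
Proof.
move=> sp; exists #|T|, (fun i => w (enum_val i)).
apply/seteqP; split=> v /=.
  move=> [c ->]; apply/sp; exists (fun t => c (enum_rank t)).
  rewrite [RHS](reindex _ (onW_bij _ (@enum_val_bij T))) /=.
  by apply: eq_bigr => i _; rewrite enum_valK.
move=> /sp [c ->]; exists (fun i => c (enum_val i)).
by rewrite [LHS](reindex _ (onW_bij _ (@enum_val_bij T))).
Qed.

(** A spanning family is a surjection from row vectors onto [V], and a complement [S^C] of its
    kernel maps isomorphically onto [V]. The coordinates of [S^C] are the coordinates sought, so no
    basis has to be extracted from the family. *)
Lemma finite_dim_iso (V : lmodType K) :
  finite_dim [set: V] -> exists (n : nat) (r : V -> 'rV[K]_n), linear r /\ bijective r.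
Proof.
move=> [n [w spw]].
pose pi := fun r : 'rV[K]_n => \sum_i r 0 i *: w i.
have pi_lin : linear pi.
  move=> c x y; rewrite /pi scaler_sumr -big_split /=; apply: eq_bigr => i _.
  by rewrite !mxE scalerDl scalerA.
pose piL : {linear 'rV[K]_n -> V} := HB.pack pi (GRing.isLinear.Build _ _ _ _ pi pi_lin).
have [S SE] : exists S : {vspace 'rV[K]_n}, forall r, r \in S <-> piL r = 0.
  apply: subspace_vspace; split=> [|c u v]; first exact: linear0.
  by move=> u0 v0; rewrite linearP u0 v0 scaler0 addr0.
have surj v : exists x : subvs_of S^C, piL (vsval x) = v.
  have [c vE] : lspan w v by rewrite spw.
  have /memv_addP [s /SE s0 [x xC /esym rE]] : \row_i c i \in (S + S^C)%VS.
    by rewrite addv_complf memvf.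
  exists (vsproj S^C x); rewrite vsprojK //.
  rewrite -[LHS]add0r -s0 -linearD rE vE /= /pi.
  by apply: eq_bigr => i _; rewrite mxE.
have inj (x y : subvs_of S^C) : piL (vsval x) = piL (vsval y) -> x = y.
  move=> xy; apply: subvs_inj; apply/eqP; rewrite -subr_eq0 -memv0 -(capv_compl S).
  rewrite memv_cap; apply/andP; split; last by rewrite rpredB ?subvsP.
  by apply/SE; rewrite linearB /= [X in X - _]xy subrr.
have [g gK] := choice surj.
have g_lin : linear g.
  by move=> c u v; apply: inj; rewrite gK -[RHS]/(piL (c *: vsval (g u) + vsval (g v))) linearP !gK.
exists (dim (subvs_of S^C)), (fun v => v2r (g v)); split.
  by move=> c u v; rewrite g_lin linearP.
apply: bij_comp.
  exists (@r2v _ _); [exact: v2rK | exact: r2vK].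
by exists (fun x => piL (vsval x)) => x; [apply: gK | apply: inj; rewrite gK].
Qed.

(** The proof [fd] is part of the type so that the coordinates chosen from it become a [vectType]
    structure; the elements are still those of [V]. *)
Definition fdvect (V : lmodType K) (fd : finite_dim [set: V]) : Type := V.

Section FdVect.
Variables (V : lmodType K) (fd : finite_dim [set: V]).

HB.instance Definition _ := GRing.Lmodule.on (fdvect fd).

Let fd_dim : nat := projT1 (cid (finite_dim_iso fd)).
Let fd_axiom : Vector.axiom fd_dim (fdvect fd).
Proof. by rewrite /fd_dim; case: cid => n /= /cid [r [rl rb]]; exists r. Qed.

HB.instance Definition _ := Lmodule_hasFinDim.Build K (fdvect fd) fd_axiom.
End FdVect.

Lemma finite_dim_vspace (X : vectType K) (S : {vspace X}) : finite_dim [set v | v \in S].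
Proof.
apply: (@finite_dim_family _ 'I_(\dim S) (fun i => (vbasis S)`_i)) => v; split=> /=.
  by move=> /coord_vbasis ->; exists (fun i => coord (vbasis S) i v).
move=> [c ->]; apply: rpred_sum => i _; apply: rpredZ.
by rewrite vbasis_mem // mem_nth // size_tuple.
Qed.

Lemma finite_dim_subspace (V : lmodType K) (W : set V) :
  finite_dim [set: V] -> subspace W -> finite_dim W.
Proof.
move=> fd sW; have [S SE] := @subspace_vspace (fdvect fd) W sW.
have := finite_dim_vspace S; congr finite_dim.
by apply/seteqP; split=> v /SE.
Qed.
End FiniteDimension.

(** * Eigenvalues of an endomorphism of a finite-dimensional space *)

Section Eigenvalues.
Variable K : numClosedFieldType.

Lemma finitely_many_eigenvalues (X : vectType K) (h : {linear X -> X}) :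
  exists r : seq K, forall c v, v != 0 -> h v = c *: v -> c \in r.
Proof.
pose A := lin1_mx (v2r \o h \o @r2v K X).
have [r rE] := closed_field_poly_normal (char_poly A).
exists r => c v vN0 hv.
have : eigenvalue A c.
  apply/eigenvalueP; exists (v2r v).
    by rewrite mul_rV_lin1 /= v2rK hv linearZ.
  apply: contra_neq vN0 => v0; apply: v2r_inj.
  by rewrite v0 linear0.
rewrite eigenvalue_root_char rE (monicP (char_poly_monic A)) scale1r.
by rewrite root_prod_XsubC.
Qed.

(** Otherwise the [c i] would be infinitely many distinct eigenvalues. This is the finiteness behind
    every ladder argument below. *)
Lemma eigenvectors_vanish (X : vectType K) (h : {linear X -> X}) (u : nat -> X) (c : nat -> K) :
  injective c -> (forall i, h (u i) = c i *: u i) -> exists i, u i = 0.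
Proof.
move=> cI hu; have [r rP] := finitely_many_eigenvalues h.
apply: contrapT => /forallNP uN0.
have : (size [seq c i | i <- iota 0 (size r).+1] <= size r)%N.
  apply: uniq_leq_size; first by rewrite map_inj_uniq ?iota_uniq.
  by move=> _ /mapP [i _ ->]; apply: (rP _ (u i)); [apply/eqP; apply: uN0 | apply: hu].
by rewrite size_map size_iota ltnn.
Qed.
End Eigenvalues.

(** * Modules over enveloping algebras from representations *)

Section Representation.
Variables (K : fieldType) (L : lieAlgType K) (E : lmodType K).

Record representation := Representation {
  rho :> L -> E -> E;
  rho_linearl : forall v, linear (rho^~ v);
  rho_linearr : forall x, linear (rho x);
  rho_lie : forall x y v, rho (lie x y) v = rho x (rho y v) - rho y (rho x v) }.

Variable r : representation.

Fixpoint uterm_act (t : uterm L) (v : E) : E :=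
  match t with
  | TGen x => r x v
  | TScal c => c *: v
  | TAdd t u => uterm_act t v + uterm_act u v
  | TMul t u => uterm_act t (uterm_act u v)
  end.

Lemma uterm_act_linear t : linear (uterm_act t).
Proof.
elim: t => [x|a|t IHt u IHu|t IHt u IHu] c v w /=.
- exact: rho_linearr.
- by rewrite scalerDr !scalerA mulrC.
- by rewrite IHt IHu scalerDr addrACA.
- by rewrite IHu IHt.
Qed.

Lemma uterm_actD t v w : uterm_act t (v + w) = uterm_act t v + uterm_act t w.
Proof. by have := uterm_act_linear t 1 v w; rewrite !scale1r. Qed.

Lemma uterm_actZ t c v : uterm_act t (c *: v) = c *: uterm_act t v.
Proof.
have t0 : uterm_act t 0 = 0.
  by apply: (addIr (uterm_act t 0)); rewrite -uterm_actD !add0r.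
by have := uterm_act_linear t c v 0; rewrite t0 !addr0.
Qed.

(** The universal property of U(L): each relation imposed on formal expressions holds for the
    operators on [E], the bracket relation being [rho_lie]. *)
Lemma uterm_actP t u : uequiv t u -> uterm_act t = uterm_act u.
Proof.
move=> tu; apply/funext => v; elim: tu v => /= {t u}.
- by [].
- by move=> t u _ IH v; rewrite IH.
- by move=> t u w _ IHt _ IHu v; rewrite IHt IHu.
- by move=> t t' u u' _ IHt _ IHu v; rewrite IHt IHu.
- by move=> t t' u u' _ IHt _ IHu v; rewrite IHt IHu.
- by move=> t u w v; rewrite addrA.
- by move=> t u v; rewrite addrC.
- by move=> t v; rewrite scale0r add0r.
- by [].
- by move=> t v; rewrite scale1r.
- by move=> t v; rewrite !scale0r.
- by [].
- by move=> t u w v; rewrite uterm_actD.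
- by move=> a b v; rewrite scalerDl.
- by move=> a b v; rewrite scalerA.
- by move=> a t v; rewrite uterm_actZ.
- by move=> a x y v; rewrite rho_linearl.
- by move=> x y v; rewrite rho_lie addrC subrK.
Qed.

(** The representation is kept in the type so that the U(L)-module structure does not collide with
    the K-structure of [E]. *)
Definition repmod of representation : Type := E.

HB.instance Definition _ := GRing.Zmodule.on (repmod r).

Definition uact (u : uea L) (v : repmod r) : repmod r := uterm_act (urepr u) v.

Lemma uactE t v : uact (uclass t) v = uterm_act t v.
Proof. by rewrite /uact (uterm_actP (urepr_uclass t)). Qed.

Lemma uactA a b v : uact a (uact b v) = uact (a * b) v.
Proof. by elim/uea_ind: a => t; elim/uea_ind: b => u; rewrite -uclassM !uactE. Qed.
Lemma uact1 : left_id 1 uact.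
Proof. by move=> v; rewrite -[1]scale1r -uclassS uactE /= scale1r. Qed.
Lemma uactDr : right_distributive uact +%R.
Proof. by move=> a u v; apply: uterm_actD. Qed.
Lemma uactDl v : {morph uact^~ v : a b / a + b}.
Proof. by elim/uea_ind=> t; elim/uea_ind=> u; rewrite -uclassD !uactE. Qed.

HB.instance Definition _ := GRing.Zmodule_isLmodule.Build (uea L) (repmod r)
  uactA uact1 uactDr uactDl.

Lemma repmod_gen (x : L) (v : repmod r) : ugen x *: v = r x v.
Proof. exact: uactE. Qed.

Lemma repmod_scalar (c : K) (v : repmod r) : c%:A *: v = (c *: (v : E) : E).
Proof. by rewrite -uclassS; exact: uactE. Qed.
End Representation.

(** * Representations of the Schrödinger algebra from six operators *)

Section Commutators.
Variables (K : fieldType).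
Implicit Types x y : sbasis.

Lemma sum_svec (u : schrodinger K) : u = \sum_x (u x : K) *: svec K x.
Proof.
apply/ffunP => y; rewrite sum_ffunE (bigD1 y) //= big1 ?addr0 => [|x xy].
  by rewrite !ffunE eqxx [RHS]mulr1.
by rewrite !ffunE eq_sym (negPf xy) [LHS]mulr0.
Qed.

Lemma lie_svec x y : lie (svec K x) (svec K y) = slisted K x y - slisted K y x.
Proof.
rewrite [LHS](bigD1 x) //= [X in _ + X]big1 ?addr0 => [|a ax]; last first.
  by rewrite big1 // => b _; rewrite !ffunE (negPf ax) mul0r scale0r.
rewrite (bigD1 y) //= big1 ?addr0 => [|b bY]; last first.
  by rewrite !ffunE (negPf bY) mulr0 scale0r.
by rewrite !ffunE !eqxx mulr1 scale1r.
Qed.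

Variables (E : lmodType K) (op : sbasis -> {linear E -> E}).
Hypothesis op_lie : forall x y v,
  op x (op y v) - op y (op x v) = \sum_z ((slisted K x y - slisted K y x) z : K) *: op z v.

Definition srho (u : schrodinger K) (v : E) : E := \sum_x (u x : K) *: op x v.

Lemma srho_linearl v : linear (srho^~ v).
Proof.
move=> c u w; rewrite /srho scaler_sumr -big_split /=; apply: eq_bigr => x _.
by rewrite !ffunE scalerDl scalerA.
Qed.

Lemma srho_linearr u : linear (srho u).
Proof.
move=> c v w; rewrite /srho scaler_sumr -big_split /=; apply: eq_bigr => x _.
by rewrite linearP scalerDr !scalerA mulrC.
Qed.

Lemma srho_lie u w v : srho (lie u w) v = srho u (srho w v) - srho w (srho u v).
Proof.
pose s : {linear schrodinger K -> E} :=
  HB.pack (srho^~ v) (GRing.isLinear.Build _ _ _ _ (srho^~ v) (srho_linearl v)).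
have srho2 a b : srho a (srho b v) = \sum_x \sum_y (a x * b y : K) *: op x (op y v).
  rewrite {1}/srho; apply: eq_bigr => x _; rewrite linear_sum scaler_sumr.
  by apply: eq_bigr => y _; rewrite linearZ scalerA.
rewrite !srho2 [X in _ - X]exchange_big -sumrB -[LHS]/(s (sbracket u w)) linear_sum.
apply: eq_bigr => x _; rewrite linear_sum -sumrB; apply: eq_bigr => y _.
by rewrite [w y * _]mulrC -scalerBr op_lie linearZ.
Qed.

Definition schrodinger_rep : representation (schrodinger K) E :=
  Representation srho_linearl srho_linearr srho_lie.

Lemma schrodinger_repE x (v : repmod schrodinger_rep) : ub K x *: v = op x v.
Proof.
rewrite [LHS]repmod_gen /= /srho (bigD1 x) //= big1 ?addr0 => [|y yx].
  by rewrite ffunE eqxx scale1r.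
by rewrite ffunE (negPf yx) scale0r.
Qed.
End Commutators.

(** * From equivariance under the basis to U(s)-linearity *)

Section Equivariance.
Variables (K : fieldType) (M N : lmodType (Us K)) (phi : Defs.restrict M -> Defs.restrict N).
Hypothesis phi_lin : linear phi.

Let phiD v w : phi (v + w) = phi v + phi w.
Proof. by have := phi_lin 1 v w; rewrite !scale1r. Qed.

Let phi0 : phi 0 = 0.
Proof. by apply: (addIr (phi 0)); rewrite -phiD !add0r. Qed.

Let phiZ (c : K) (v : M) : phi (c%:A *: v) = c%:A *: (phi v : N).
Proof. by have := phi_lin c v 0; rewrite phi0 !addr0. Qed.

Definition equivariant (u : Us K) : Prop :=
  forall v : M, phi (u *: v) = u *: (phi v : N).

Lemma equivariantD u w : equivariant u -> equivariant w -> equivariant (u + w).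
Proof. by move=> hu hw v; rewrite !scalerDl -hu -hw; exact: phiD. Qed.

Lemma equivariantM u w : equivariant u -> equivariant w -> equivariant (u * w).
Proof. by move=> hu hw v; rewrite -!scalerA hu hw. Qed.

Lemma equivariantZ (c : K) u : equivariant u -> equivariant (c *: u).
Proof. by move=> hu; rewrite -mulr_algl; apply: equivariantM => // v; exact: phiZ. Qed.

Lemma equivariantB u w : equivariant u -> equivariant w -> equivariant (u - w).
Proof. by move=> hu hw; rewrite -scaleN1r; apply/equivariantD/equivariantZ. Qed.

(** The elements of U(s) that commute with [phi] are closed under sums, products and scalars, so
    induction over formal expressions applies. *)
Lemma equivariant_Us : (forall x, equivariant (ub K x)) -> forall u, equivariant u.
Proof.
move=> hb; elim/uea_ind; elim=> [u|c|t IHt u IHu|t IHt u IHu].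
- rewrite -/(ugen u) [u]sum_svec.
  pose s : {linear schrodinger K -> Us K} := HB.pack (@ugen K (schrodinger K))
    (GRing.isLinear.Build _ _ _ _ (@ugen K (schrodinger K)) (@ugen_linear _ _)).
  rewrite -[ugen _]/(s _) linear_sum; elim/big_rec: _ => [v|x w _ hw].
    by rewrite !scale0r; exact: phi0.
  by apply: equivariantD => //; rewrite linearZ; apply/equivariantZ/hb.
- by rewrite uclassS => v; exact: phiZ.
- by rewrite uclassD; apply: equivariantD.
- by rewrite uclassM; apply: equivariantM.
Qed.
End Equivariance.

(** * Polynomial model attached to a quiver representation *)

Section Model.
Variables (K : numClosedFieldType) (V : Qrep K).

Implicit Types g : forall n, nat -> V n.

(* The scaling turns the relation ab = ba into (n+3) b' a = (n+1) a b' on V_(n+1),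
   which is the identity needed for p and q to commute. *)
Definition model_down n : 'Hom(V n.+1, V n) := - (n.+1%:R * n.+2%:R)^-1 *: qb V n.

(* g n k is the coefficient of x^(n-k) y^k. *)
Definition model_e g n k : V n := k.+1%:R *: g n k.+1.
(** The factor n - k is a difference in [K], not a truncated one, so the commutation relations hold
    for all k, as if negative powers of x were allowed; its vanishing at k = n is what keeps
    polynomials polynomial. *)
Definition model_f g n k : V n :=
  if k is k'.+1 then (n%:R - k'%:R) *: g n k' else 0.
Definition model_h g n k : V n := (n%:R - 2%:R * k%:R) *: g n k.
Definition model_up g n k : V n :=
  match n return V n with 0 => 0 | n'.+1 => qa V n' (g n' k) end.
Definition model_p g n k : V n := model_up g n k + k.+1%:R *: model_down n (g n.+1 k.+1).
Definition model_q g n k : V n :=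
  (if k is k'.+1 then model_up g n k' else 0) - (n.+1%:R - k%:R) *: model_down n (g n.+1 k).

Definition model_op x g : forall n, nat -> V n :=
  match x with
  | se => model_e g | sh => model_h g | sf => model_f g
  | sp => model_p g | sq => model_q g | sz => fun n k => 0
  end.

Lemma model_down_up0 (v : V 0) : model_down 0 (qa V 0 v) = 0.
Proof.
have := congr1 (fun f : 'End(V 0) => f v) (q_rel0 V).
by rewrite /= comp_lfunE zero_lfunE scale_lfunE => ->; rewrite scaler0.
Qed.

Lemma model_down_up n (v : V n.+1) :
  n.+3%:R *: model_down n.+1 (qa V n.+1 v) = n.+1%:R *: qa V n (model_down n v).
Proof.
have := congr1 (fun f : 'End(V n.+1) => f v) (q_rel V n).
rewrite /= !comp_lfunE !scale_lfunE [qa V n (_ *: _)]linearZ /= => ->.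
rewrite !scalerA; congr (_ *: _); rewrite -[n.+3]addn3 -[n.+2]addn2 -[n.+1]addn1.
have nz m : n%:R + m.+1%:R != 0 :> K by rewrite -natrD addnS pnatr_eq0.
by field; apply/and3P; split; [exact: (nz 1%N) | exact: (nz 0%N) | exact: (nz 2%N)].
Qed.
Lemma coord_ext n (x y : V n) : (forall j, v2r x 0 j = v2r y 0 j) -> x = y.
Proof. by move=> xy; apply/v2r_inj/rowP. Qed.

Lemma coord0 n j : v2r (0 : V n) 0 j = 0.
Proof. by rewrite linear0 mxE. Qed.
Lemma coordD n (x y : V n) j : v2r (x + y) 0 j = v2r x 0 j + v2r y 0 j.
Proof. by rewrite linearD mxE. Qed.
Lemma coordN n (x : V n) j : v2r (- x) 0 j = - v2r x 0 j.
Proof. by rewrite linearN mxE. Qed.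
Lemma coordZ n c (x : V n) j : v2r (c *: x) 0 j = c * v2r x 0 j.
Proof. by rewrite linearZ mxE. Qed.

Lemma lfunD n m (f : 'Hom(V n, V m)) x y : f (x + y) = f x + f y.
Proof. exact: linearD. Qed.
Lemma lfunN n m (f : 'Hom(V n, V m)) x : f (- x) = - f x.
Proof. exact: linearN. Qed.
Lemma lfunZ n m (f : 'Hom(V n, V m)) c x : f (c *: x) = c *: f x.
Proof. exact: linearZ. Qed.
Lemma lfun0 n m (f : 'Hom(V n, V m)) : f 0 = 0.
Proof. exact: linear0. Qed.

(** Passing to coordinates turns an identity of vectors into one of scalars, where [ring]
    applies. *)
Ltac coords :=
  apply: coord_ext => j; rewrite /= ?(lfunD, lfunN, lfunZ, lfun0);
  rewrite ?(coordD, coordN, coordZ, coord0).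

Lemma model_ef g n k : model_e (model_f g) n k = model_f (model_e g) n k + model_h g n k.
Proof.
rewrite /model_e /model_f /model_h; case: k => [|k]; coords; ring.
Qed.
Lemma model_he g n k : model_h (model_e g) n k = model_e (model_h g) n k + 2%:R *: model_e g n k.
Proof. by rewrite /model_e /model_f /model_h; coords; ring. Qed.
Lemma model_hf g n k : model_h (model_f g) n k = model_f (model_h g) n k - 2%:R *: model_f g n k.
Proof. by rewrite /model_e /model_f /model_h; case: k => [|k]; coords; ring. Qed.
Lemma model_eq g n k : model_e (model_q g) n k = model_q (model_e g) n k + model_p g n k.
Proof. rewrite /model_e /model_q /model_p; case: n k => [|n] [|k]; coords; ring. Qed.
Lemma model_ep g n k : model_e (model_p g) n k = model_p (model_e g) n k.
Proof. rewrite /model_e /model_q /model_p; case: n k => [|n] [|k]; coords; ring. Qed.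
Lemma model_fp g n k : model_f (model_p g) n k = model_p (model_f g) n k + model_q g n k.
Proof. rewrite /model_f /model_q /model_p; case: n k => [|n] [|k]; coords; ring. Qed.
Lemma model_fq g n k : model_f (model_q g) n k = model_q (model_f g) n k.
Proof. rewrite /model_f /model_q /model_p; case: n k => [|n] [|[|k]]; coords; ring. Qed.
Lemma model_hp g n k : model_h (model_p g) n k = model_p (model_h g) n k + model_p g n k.
Proof. rewrite /model_h /model_q /model_p; case: n k => [|n] [|k]; coords; ring. Qed.
Lemma model_hq g n k : model_h (model_q g) n k = model_q (model_h g) n k - model_q g n k.
Proof. rewrite /model_h /model_q /model_p; case: n k => [|n] [|k]; coords; ring. Qed.
(** The terms in aa and b'b' cancel because multiplications commute with each other, and so do
    derivations. The mixed terms combine, through the Euler operator, into (n+2) b'a - n ab' on V_n;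
    at n = 0 only b'a is left and [model_down_up0] kills it. *)
Lemma model_pq g n k : model_p (model_q g) n k = model_q (model_p g) n k.
Proof.
rewrite /model_q /model_p; case: n => [|n].
  by case: k => [|k]; coords; rewrite ?model_down_up0 ?linear0 ?mxE; ring.
have D k' j : n.+3%:R * v2r (model_down n.+1 (qa V n.+1 (g n.+1 k'))) 0 j =
    n.+1%:R * v2r (qa V n (model_down n (g n.+1 k'))) 0 j.
  by have := congr1 (fun v => v2r v 0 j) (model_down_up (g n.+1 k')); rewrite !linearZ !mxE.
case: k => [|k]; coords.
  apply/eqP; rewrite -subr_eq0; apply/eqP.
  by rewrite -[RHS](subrr (n.+1%:R * v2r (qa V n (model_down n (g n.+1 0%N))) 0 j)) -{1}D; ring.
apply/eqP; rewrite -subr_eq0; apply/eqP.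
by rewrite -[RHS](subrr (n.+1%:R * v2r (qa V n (model_down n (g n.+1 k.+1))) 0 j)) -{1}D; ring.
Qed.
End Model.

(** * The module of polynomials with coefficients in the V_n *)

Section ModelSpace.
Variables (K : numClosedFieldType) (V : Qrep K).

(* Finiteness of the support in n is automatic, as V_n = 0 for large n. *)
Record model := Model {
  coef :> forall n, nat -> V n;
  coef_out : forall n k, (n < k)%N -> coef n k = 0 }.

Lemma model_ext (g g' : model) : (forall n k, g n k = g' n k) -> g = g'.
Proof.
case: g => g og; case: g' => g' og' /= gg'.
have E : g = g'.
  by apply: functional_extensionality_dep => n; apply/funext => k.
by subst g'; congr Model; apply: Prop_irrelevance.
Qed.

HB.instance Definition _ := gen_eqMixin model.
HB.instance Definition _ := gen_choiceMixin model.

Definition model0 : model := @Model (fun n k => 0) (fun _ _ _ => erefl).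
Lemma model_add_out (g g' : model) n k : (n < k)%N -> g n k + g' n k = 0.
Proof. by move=> nk; rewrite !coef_out // addr0. Qed.
Definition model_add (g g' : model) : model := Model (@model_add_out g g').
Lemma model_scale_out c (g : model) n k : (n < k)%N -> c *: g n k = 0.
Proof. by move=> nk; rewrite coef_out // scaler0. Qed.
Definition model_scale c (g : model) : model := Model (@model_scale_out c g).
Definition model_opp (g : model) : model := model_scale (-1) g.

Lemma model_addA : associative model_add.
Proof. by move=> f g h; apply: model_ext => n k; apply: addrA. Qed.
Lemma model_addC : commutative model_add.
Proof. by move=> f g; apply: model_ext => n k; apply: addrC. Qed.
Lemma model_add0 : left_id model0 model_add.
Proof. by move=> f; apply: model_ext => n k; apply: add0r. Qed.
Lemma model_addN : left_inverse model0 model_opp model_add.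
Proof. by move=> f; apply: model_ext => n k /=; rewrite scaleN1r addNr. Qed.

HB.instance Definition _ :=
  GRing.isZmodule.Build model model_addA model_addC model_add0 model_addN.

Lemma model_scaleA a b g : model_scale a (model_scale b g) = model_scale (a * b) g.
Proof. by apply: model_ext => n k; apply: scalerA. Qed.
Lemma model_scale1 : left_id 1 model_scale.
Proof. by move=> g; apply: model_ext => n k; apply: scale1r. Qed.
Lemma model_scaleDr : right_distributive model_scale +%R.
Proof. by move=> c f g; apply: model_ext => n k; apply: scalerDr. Qed.
Lemma model_scaleDl g : {morph model_scale^~ g : a b / a + b}.
Proof. by move=> a b; apply: model_ext => n k; apply: scalerDl. Qed.

HB.instance Definition _ := GRing.Zmodule_isLmodule.Build K model
  model_scaleA model_scale1 model_scaleDr model_scaleDl.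

Definition coef_at n k (g : model) : V n := g n k.
Lemma coef_at_linear n k : linear (coef_at n k). Proof. by []. Qed.
HB.instance Definition _ n k :=
  GRing.isLinear.Build K model (V n) _ (coef_at n k) (coef_at_linear n k).

Lemma model_coef_sum (I : Type) (s : seq I) (P : pred I) (F : I -> model) n k :
  (\sum_(i <- s | P i) F i) n k = \sum_(i <- s | P i) F i n k.
Proof. by rewrite -[LHS]/(coef_at n k _) linear_sum. Qed.

(** Only [f] and [q] have terms that could cross the boundary k = n, and the factors n - k and n + 1
    - k vanish exactly there. *)
Lemma model_op_out x (g : model) n k : (n < k)%N -> model_op x g n k = 0.
Proof.
have A0 (h : model) k' : (n <= k')%N -> model_up h n k' = 0.
  by case: n => // m mk /=; rewrite coef_out // linear0.
case: x => //= nk; rewrite ?/model_e ?/model_h ?/model_p ?coef_out ?scaler0 //.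
- exact: leqW.
- rewrite /model_f; case: k nk => // k; rewrite ltnS leq_eqVlt => /orP [/eqP->|nk].
    by rewrite subrr scale0r.
  by rewrite coef_out ?scaler0.
- by rewrite A0 1?ltnW // linear0 scaler0 addr0.
- rewrite /model_q; case: k nk => // k; rewrite ltnS => nk.
  rewrite A0 // sub0r; move: nk; rewrite leq_eqVlt => /orP [/eqP->|nk].
    by rewrite subrr scale0r oppr0.
  by rewrite coef_out // linear0 scaler0 oppr0.
Qed.

Definition op_model x (g : model) : model := Model (@model_op_out x g).

Lemma op_model_linear x : linear (op_model x).
Proof.
move=> c f g; apply: model_ext => n k.
rewrite -[RHS]/(c *: model_op x f n k + model_op x g n k).
rewrite -[LHS]/(model_op x (c *: f + g) n k).
have upL m k' : model_up (c *: f + g) m k' = c *: model_up f m k' + model_up g m k'.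
  by case: m => [|m] /=; rewrite ?scaler0 ?addr0 // linearP.
have coefL m k' : (c *: f + g) m k' = c *: f m k' + g m k' by [].
case: x; rewrite /model_op.
- by rewrite /model_e coefL scalerDr !scalerA mulrC.
- by rewrite /model_h coefL scalerDr !scalerA mulrC.
- rewrite /model_f; case: k => [|k]; first by rewrite scaler0 addr0.
  by rewrite coefL scalerDr !scalerA mulrC.
- by rewrite /model_p coefL upL linearP !scalerDr !scalerA [c * _]mulrC addrACA.
- rewrite /model_q coefL linearP; case: k => [|k].
    by rewrite !sub0r !scalerDr !scalerN !scalerA opprD mulrC.
  by rewrite upL !scalerDr !scalerN !scalerA opprD addrACA [_ * c]mulrC.
- by rewrite scaler0 addr0.
Qed.

HB.instance Definition _ x :=
  GRing.isLinear.Build K model model _ (op_model x) (op_model_linear x).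

Lemma op_model_lie x y (g : model) :
  op_model x (op_model y g) - op_model y (op_model x g) =
  \sum_z ((slisted K x y - slisted K y x) z : K) *: op_model z g.
Proof.
have sub (a b c : model) : (forall n k, a n k = b n k + c n k) -> a - b = c.
  by move=> E; apply/eqP; rewrite subr_eq addrC; apply/eqP/model_ext.
pose listed x y : model := match x, y with
  | sh, se => 2%:R *: op_model se g
  | se, sf => op_model sh g
  | sh, sf => - (2%:R *: op_model sf g)
  | se, sq => op_model sp g
  | sh, sp => op_model sp g
  | sf, sp => op_model sq g
  | sh, sq => - op_model sq g
  | sp, sq => op_model sz g
  | _, _ => 0 end.
have -> : \sum_z ((slisted K x y - slisted K y x) z : K) *: op_model z g =
    listed x y - listed y x.
  have sl a b : \sum_z (slisted K a b z : K) *: op_model z g = listed a b.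
    rewrite sum_sbasis !slistedE.
    by case: a; case: b; rewrite /= ?scale0r ?add0r ?addr0 ?scaleNr ?scale1r.
  rewrite -!sl -sumrB; apply: eq_bigr => z _.
  by rewrite ffunE [X in (_ + X) *: _]ffunE scalerBl.
have opz (h : model) : op_model sz h = 0 by apply: model_ext.
(* These are the ten unordered pairs without z, each in the order in which its bracket is listed, if
   it is listed at all. Antisymmetry, the diagonal and the centrality of z cover the other ordered
   pairs. *)
have L a b : (a, b) \in [:: (sh, se); (se, sf); (sh, sf); (se, sq); (sh, sp);
    (sf, sp); (sh, sq); (sp, sq); (se, sp); (sf, sq)] ->
    op_model a (op_model b g) - op_model b (op_model a g) = listed a b.
  rewrite !inE !xpair_eqE => /or4P [|||/or4P [|||/or4P [|||]]];
    move=> /andP [/eqP -> /eqP ->]; apply: sub => n k.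
  - exact: model_he.
  - exact: model_ef.
  - by rewrite /listed -scaleNr [RHS]/(_ + - 2%:R *: model_f g n k) scaleNr; exact: model_hf.
  - exact: model_eq.
  - exact: model_hp.
  - exact: model_fp.
  - by rewrite /listed -scaleN1r [RHS]/(_ + - 1 *: model_q g n k) scaleN1r; exact: model_hq.
  - by rewrite [RHS]addr0; exact: model_pq.
  - by rewrite [RHS]addr0; exact: model_ep.
  - by rewrite [RHS]addr0; exact: model_fq.
have z_central a b : (a == sz) || (b == sz) ->
    op_model a (op_model b g) - op_model b (op_model a g) = listed a b - listed b a.
  by move=> /orP [] /eqP ->; rewrite !opz linear0; [case: b | case: a].
case: x; case: y; first
  [ by rewrite !subrr | exact: z_central | by rewrite L // [RHS]subr0
  | by rewrite -opprB L // [RHS]sub0r ].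
Qed.

Definition model_rep : representation (schrodinger K) model :=
  schrodinger_rep op_model_lie.

Definition model_module : lmodType (Us K) := repmod model_rep.

Lemma model_moduleE x (g : model_module) : ub K x *: g = op_model x g.
Proof. exact: schrodinger_repE. Qed.

Lemma model_module_scalar c (g : model_module) : c%:A *: g = c *: (g : model) :> model.
Proof. exact: repmod_scalar. Qed.

(** The coefficients of the monomial x^(n-k) y^k v. Since they lie in varying spaces, v is
    transported along n = m; the guard on k makes the monomial 0 when k > n, so that it is an
    element of [model] for every k. *)
Definition delta_coef n k (v : V n) m l : V m :=
  if n =P m is ReflectT e then
    if (l == k) && (k <= n)%N then eq_rect n (fun i => V i : Type) v m e else 0
  else 0.

Lemma delta_coef_out n k (v : V n) m l : (m < l)%N -> delta_coef k v m l = 0.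
Proof.
rewrite /delta_coef; case: eqP => // e ml; case: ifP => // /andP [/eqP lk kn].
by exfalso; move: ml; rewrite lk -e ltnNge kn.
Qed.

Definition delta n k (v : V n) : model := Model (@delta_coef_out n k v).

Lemma delta_at n k (v : V n) : (k <= n)%N -> delta k v n k = v.
Proof.
move=> kn; rewrite /= /delta_coef; case: eqP => // e.
by rewrite eqxx kn /= (eq_axiomK e).
Qed.

Lemma delta_off n k (v : V n) m l : (m, l) != (n, k) -> delta k v m l = 0.
Proof.
rewrite /= /delta_coef => neq; case: eqP => // e; case: ifP => // /andP [lk _].
by exfalso; move: neq; rewrite xpair_eqE e eqxx lk.
Qed.

Lemma delta_linear n k : linear (@delta n k).
Proof.
move=> c v w; apply: model_ext => m l.
rewrite -[RHS]/(c *: delta k v m l + delta k w m l).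
have [kn|nk] := leqP k n; last first.
  by rewrite /= /delta_coef; case: eqP => [e|_]; rewrite ?[(k <= n)%N]leqNgt ?nk ?andbF ?scaler0 ?addr0.
have [[-> ->]|neq] := eqVneq (m, l) (n, k); first by rewrite !delta_at.
by rewrite !delta_off // scaler0 addr0.
Qed.

HB.instance Definition _ n k :=
  GRing.isLinear.Build K (V n) model _ (@delta n k) (@delta_linear n k).

(** The range of k goes beyond n, where the coefficients are 0; a range independent of n gives a
    simpler index type for the spanning family. *)
Lemma model_sum_delta N (g : model) : (forall n (v : V n), (N <= n)%N -> v = 0) ->
  g = \sum_(n < N) \sum_(k < N) delta k (g n k).
Proof.
move=> VN; apply: model_ext => m l; rewrite model_coef_sum.
under eq_bigr => n _ do rewrite model_coef_sum.
have [mN|Nm] := ltnP m N; last first.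
  rewrite (VN _ (g m l)) // big1 // => n _; rewrite big1 // => k _.
  exact: VN.
have [ml|lm] := ltnP m l.
  rewrite coef_out // big1 // => n _; rewrite big1 // => k _.
  by rewrite coef_out.
have lN := leq_ltn_trans lm mN.
rewrite (big_only1 (Ordinal mN)) // => [|n nm _]; last first.
  rewrite big1 // => k _; rewrite delta_off // xpair_eqE negb_and (eq_sym m).
  by rewrite [nat_of_ord n == m](negPf nm).
rewrite (big_only1 (Ordinal lN)) // => [|k kl _]; last first.
  by rewrite delta_off // xpair_eqE eqxx (eq_sym l) [nat_of_ord k == l](negPf kl).
by rewrite delta_at.
Qed.
End ModelSpace.

(** * Membership in category O and the weights of the model *)

Section FiniteDimensionalModules.
Variables (K : fieldType).

Lemma finite_dim_generated (A : lalgType K) (M : lmodType A) :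
  finite_dim [set: Defs.restrict M] -> finitely_generated M.
Proof.
move=> [n [w spw]]; exists n, w; apply/seteqP; split=> // v _.
have [c ->] : lspan w v by rewrite spw.
by exists (fun i => (c i)%:A).
Qed.

Variable M : lmodType (Us K).

Lemma subalgebra_generated_subalgebra (A : lalgType K) (X : set A) :
  is_subalgebra (subalgebra_generated X).
Proof.
split=> [B [[] //]|c x y Bx By B BX|x y Bx By B BX].
  by have [[_ lin _] _] := BX; apply: lin; [apply: Bx | apply: By].
by have [[_ _ mul] _] := BX; apply: mul; [apply: Bx | apply: By].
Qed.

Lemma finite_dim_in_category_O :
  finite_dim [set: Defs.restrict M] -> weight_module M -> in_category_O M.
Proof.
move=> fd wt; split=> // [|v]; first exact: finite_dim_generated.
apply: finite_dim_subspace => //.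
have [U1 Ulin _] : is_subalgebra (@Un_plus K) by exact: subalgebra_generated_subalgebra.
split=> [|c x y [u Uu <-] [w Uw <-]].
  exists 0; last by rewrite scale0r.
  by rewrite -(addNr 1) -scaleN1r; apply: Ulin.
exists (c *: u + w); first exact: Ulin.
by rewrite scalerDl -mulr_algl -scalerA.
Qed.
End FiniteDimensionalModules.

Section ModelObject.
Variables (K : numClosedFieldType) (V : Qrep K).

Lemma finite_support_bound :
  finite_set [set i | \dim {: V i} <> 0%N] ->
  exists N, forall n (v : V n), (N <= n)%N -> v = 0.
Proof.
move=> /finite_seqP [s sE]; exists (\max_(i <- s) i).+1 => n v Nn.
apply/eqP; apply: contraTT Nn => vN0; rewrite -ltnNge ltnS.
have : [set i | \dim {: V i} <> 0%N]%classic n.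
  move=> /eqP; rewrite dimv_eq0 => /eqP V0; move: vN0.
  by rewrite -memv0 -V0 memvf.
rewrite sE /= => ns; exact: (leq_bigmax_seq (F := id)).
Qed.

Variable N : nat.
Hypothesis VN : forall n (v : V n), (N <= n)%N -> v = 0.

Lemma model_finite_dim : finite_dim [set: Defs.restrict (model_module V)].
Proof.
pose T := {n : 'I_N & ('I_N * 'I_(\dim {: V n}))%type}.
apply: (@finite_dim_family _ (Defs.restrict (model_module V)) T
  (fun t : T => delta (tagged t).1 (vbasis {: V (tag t)})`_(tagged t).2)) => v; split=> // _.
exists (fun t : T => coord (vbasis {: V (tag t)}) (tagged t).2 (coef v (tag t) (tagged t).1)).
under eq_bigr => t _ do rewrite [_ *: _]model_module_scalar.
pose F n (p : 'I_N * 'I_(\dim {: V n})) : model V :=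
  coord (vbasis {: V n}) p.2 (coef v n p.1) *: delta p.1 (vbasis {: V n})`_p.2.
transitivity (\sum_(n < N) \sum_p F n p); last by rewrite sig_big_dep.
rewrite [LHS](model_sum_delta v VN).
apply: eq_bigr => n _; rewrite -(pair_bigA _ (fun k i => F n (k, i))).
apply: eq_bigr => k _; rewrite {1}(coord_vbasis (memvf (coef v n k))) linear_sum.
by apply: eq_bigr => i _; rewrite linearZ.
Qed.

(** Both h and z are diagonal on monomials, so being a weight vector is a condition on the
    support. *)
Lemma model_weight_spaceP (lam : K * K) (g : model_module V) :
  weight_space lam g <->
  (forall n k, coef g n k != 0 -> lam = (n%:R - 2%:R * k%:R, 0)).
Proof.
split=> [[/= hg zg] n k gN0|gE].
  rewrite model_moduleE model_module_scalar in hg.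
  rewrite model_moduleE model_module_scalar in zg.
  have := congr1 (fun f => coef f n k) zg; have := congr1 (fun f => coef f n k) hg.
  case: lam {hg zg} => a b /=; rewrite /model_h => /eqP.
  rewrite -subr_eq0 -[a *: _]/(a *: coef g n k) -scalerBl scaler_eq0 (negPf gN0) orbF subr_eq0.
  move=> /eqP -> /eqP; rewrite eq_sym -[b *: _]/(b *: coef g n k) scaler_eq0 (negPf gN0) orbF.
  by move=> /eqP ->.
split; rewrite model_moduleE model_module_scalar; apply: model_ext => n k /=.
  rewrite /model_h -[RHS]/(lam.1 *: coef g n k).
  by have [->|/gE ->] := eqVneq (coef g n k) 0; rewrite ?scaler0.
rewrite -[RHS]/(lam.2 *: coef g n k).
by have [->|/gE ->] := eqVneq (coef g n k) 0; rewrite ?scaler0 //= scale0r.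
Qed.

Lemma model_weight : weight_module (model_module V).
Proof.
split=> [g|s w us wP sum0 lam lams]; last first.
  apply: model_ext => n k; have [//|wN0] := eqVneq (coef (w lam) n k) 0.
  have lamE := (model_weight_spaceP lam (w lam)).1 (wP lam) n k wN0.
  have s0 : \sum_(i <- s) coef (w i) n k = 0.
    by rewrite -model_coef_sum; exact: (congr1 (fun f => coef f n k) sum0).
  rewrite -[RHS]s0 (bigD1_seq lam) //= big1 ?addr0 // => mu /eqP muN.
  apply/eqP; apply: contraT => /((model_weight_spaceP mu (w mu)).1 (wP mu) n k) muE.
  by case: muN; rewrite muE lamE.
pose wt n k : K * K := (n%:R - 2%:R * k%:R, 0).
pose cut lam := fun n k => if wt n k == lam then coef g n k else 0.
have cut_out lam n k : (n < k)%N -> cut lam n k = 0.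
  by move=> nk; rewrite /cut coef_out // if_same.
(* [undup] is needed because different monomials share a weight: (n, k) and (n+2, k+1), for
   example. *)
exists (undup [seq wt n k | n <- iota 0 N, k <- iota 0 N]), (fun lam => Model (cut_out lam)).
split; first exact: undup_uniq.
  move=> lam; apply/model_weight_spaceP => n k /=; rewrite /cut.
  by case: (wt n k =P lam) => [<-|_] //; rewrite eqxx.
apply: model_ext => n k; set S := undup _.
transitivity (\sum_(lam <- S) cut lam n k); last by symmetry; exact: model_coef_sum.
have [Nn|nN] := leqP N n; first by rewrite (VN (g n k)) // [RHS]big1 // => i _; exact: VN.
have [kn|nk] := leqP k n; last by rewrite coef_out // big1 // => i _; exact: cut_out.
rewrite (bigD1_seq (wt n k)) ?undup_uniq //=; last first.
  rewrite /S mem_undup; apply: allpairs_f; rewrite mem_iota //=; exact: leq_ltn_trans nN.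
by rewrite {1}/cut eqxx big1 ?addr0 // => mu; rewrite /cut eq_sym => /negPf ->.
Qed.
End ModelObject.

(** * Highest weight vectors of a finite-dimensional representation *)

Section Ladder.
Variables (K : numClosedFieldType) (X : vectType K) (H A : {linear X -> X}).
Variables (d : K).
Hypotheses (d0 : d != 0) (HA : forall v, H (A v) = A (H v) + d *: A v).

Lemma ladder_weight c v i : H v = c *: v -> H (iter i A v) = (c + i%:R * d) *: iter i A v.
Proof.
move=> Hv; elim: i => [|i IH]; first by rewrite mul0r addr0.
by rewrite iterS HA IH linearZ -scalerDl -addn1 natrD mulrDl mul1r addrA.
Qed.

(** The vectors A^i v have the pairwise distinct eigenvalues c + i d, so one of them is 0; the
    vector before the first zero is the top. *)
Lemma ladder_top c v : v != 0 -> H v = c *: v ->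
  exists2 i, iter i A v != 0 & A (iter i A v) = 0.
Proof.
move=> v0 Hv.
have [i /eqP ui] : exists i, iter i A v = 0.
  apply: (@eigenvectors_vanish _ _ H _ (fun i => c + i%:R * d)).
    by move=> i j /addrI /(mulIf d0) /eqP; rewrite eqr_nat => /eqP.
  by move=> i; apply: ladder_weight.
have exi : exists i, iter i A v == 0 by exists i.
case: (ex_minnP exi) => [[|k] /eqP Ak mink]; first by rewrite /= in Ak; rewrite Ak eqxx in v0.
by exists k => //; apply/negP => /mink; rewrite ltnn.
Qed.
End Ladder.

(** * Highest weight spaces and the quiver relations *)

Section RepTheory.
Variables (K : numClosedFieldType) (X : vectType K) (act : sbasis -> {linear X -> X}).
Hypothesis act_lie : forall x y v,
  act x (act y v) - act y (act x v) = \sum_z ((slisted K x y - slisted K y x) z : K) *: act z v.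

Local Notation E := (act se).
Local Notation H := (act sh).
Local Notation F := (act sf).
Local Notation P := (act sp).
Local Notation Q := (act sq).
Local Notation Z := (act sz).

Let lieE x y v : act x (act y v) = act y (act x v) +
  (\sum_z (slisted K x y z : K) *: act z v - \sum_z (slisted K y x z : K) *: act z v).
Proof.
rewrite -sumrB; apply/eqP; rewrite -subr_eq0 opprD addrA subr_eq0 act_lie.
apply/eqP; apply: eq_bigr => z _.
by rewrite ffunE [X in (_ + X) *: _]ffunE scalerBl.
Qed.

Ltac lie_bracket := move=> v; rewrite [LHS]lieE !sum_sbasis !slistedE
  ?(scale0r, add0r, addr0, subr0, scale1r, scaleN1r, scaleNr).

Lemma act_ef v : E (F v) = F (E v) + H v.
Proof. by move: v; lie_bracket. Qed.
Lemma act_he v : H (E v) = E (H v) + 2%:R *: E v.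
Proof. by move: v; lie_bracket. Qed.
Lemma act_hf v : H (F v) = F (H v) - 2%:R *: F v.
Proof. by move: v; lie_bracket. Qed.
Lemma act_eq v : E (Q v) = Q (E v) + P v.
Proof. by move: v; lie_bracket. Qed.
Lemma act_hp v : H (P v) = P (H v) + P v.
Proof. by move: v; lie_bracket. Qed.
Lemma act_fp v : F (P v) = P (F v) + Q v.
Proof. by move: v; lie_bracket. Qed.
Lemma act_hq v : H (Q v) = Q (H v) - Q v.
Proof. by move: v; lie_bracket. Qed.
Lemma act_pq v : P (Q v) = Q (P v) + Z v.
Proof. by move: v; lie_bracket. Qed.
Lemma act_ep v : E (P v) = P (E v).
Proof. by move: v; lie_bracket. Qed.
Lemma act_fq v : F (Q v) = Q (F v).
Proof. by move: v; lie_bracket. Qed.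
Lemma act_zp v : Z (P v) = P (Z v).
Proof. by move: v; lie_bracket. Qed.
Lemma act_zq v : Z (Q v) = Q (Z v).
Proof. by move: v; lie_bracket. Qed.

Lemma central_weight0 c m v : v != 0 -> H v = c *: v -> Z v = m *: v -> m = 0.
Proof.
move=> v0 Hv Zv.
have hp w : H (P w) = P (H w) + 1 *: P w by rewrite scale1r act_hp.
have hq w : H (Q w) = Q (H w) + (-1) *: Q w by rewrite scaleN1r act_hq.
have [i w0 Pw] := ladder_top (oner_neq0 K) hp v0 Hv; move: w0 Pw.
have := ladder_weight hp i Hv.
have : Z (iter i P v) = m *: iter i P v.
  by elim: i => //= i IH; rewrite act_zp IH linearZ.
move: (iter i P v) (c + _) => w b Zw Hw w0 Pw.
have N1 : -1 != 0 :> K by rewrite oppr_eq0 oner_eq0.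
have ZQ j : Z (iter j Q w) = m *: iter j Q w.
  by elim: j => //= j IH; rewrite act_zq IH linearZ.
have PQ j : P (iter j.+1 Q w) = (j.+1%:R * m) *: iter j Q w.
  elim: j => [|j IH]; first by rewrite mul1r /= act_pq Pw linear0 add0r Zw.
  rewrite [iter j.+2 _ _]iterS act_pq IH ZQ linearZ -scalerDl /=.
  by congr (_ *: _); ring.
(* At the last nonzero Q^j w, [PQ] reads 0 = (j+1) m Q^j w. *)
have [j j0 Qj] := ladder_top N1 hq w0 Hw.
have /esym/eqP := PQ j; rewrite [iter j.+1 _ _]/= Qj linear0.
by rewrite scaler_eq0 (negPf j0) orbF mulf_eq0 pnatr_eq0 => /eqP.
Qed.

(** The term in [E v] is kept, although it vanishes on highest weight vectors, because the
    surjectivity argument needs the identity for vectors where [E v] is only known to lie in the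
    image. *)
Lemma lower_raise c v k : H v = c *: v ->
  E (iter k.+1 F v) = (k.+1%:R * (c - k%:R)) *: iter k F v + iter k.+1 F (E v).
Proof.
have hf w : H (F w) = F (H w) + (- 2%:R) *: F w by rewrite scaleNr act_hf.
move=> Hv; elim: k => [|k IH]; first by rewrite mul1r subr0 /= act_ef Hv addrC.
rewrite [iter k.+2 _ v]iterS act_ef IH linearD linearZ /= (ladder_weight hf k.+1 Hv) addrAC -scalerDl.
by congr (_ *: _ + _); ring.
Qed.

Lemma iter_act0 x k : iter k (act x) 0 = 0.
Proof. by elim: k => //= k ->; rewrite linear0. Qed.

(** If F^n v is the last nonzero vector of the string, [lower_raise] gives 0 = (n+1)(c - n) F^n
    v. *)
Lemma primitive_weight c v : v != 0 -> E v = 0 -> H v = c *: v ->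
  exists n, c = n%:R /\ iter n.+1 F v = 0.
Proof.
move=> v0 Ev Hv.
have hf w : H (F w) = F (H w) + (- 2%:R) *: F w by rewrite scaleNr act_hf.
have N2 : - 2%:R != 0 :> K by rewrite oppr_eq0 pnatr_eq0.
have [n n0 Fn] := ladder_top N2 hf v0 Hv; exists n; split=> //.
have /esym/eqP := lower_raise n Hv; rewrite Ev iter_act0 addr0 [iter n.+1 _ _]/= Fn linear0.
by rewrite scaler_eq0 (negPf n0) orbF mulf_eq0 pnatr_eq0 subr_eq0 => /eqP.
Qed.

Definition primitive n : {vspace X} := (lker (linfun E) :&: lker (linfun H - n%:R *: \1%VF))%VS.

Lemma primitiveP n v : v \in primitive n <-> E v = 0 /\ H v = n%:R *: v.
Proof.
rewrite memv_cap !memv_ker lfunE /= add_lfunE opp_lfunE scale_lfunE id_lfunE lfunE subr_eq0.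
by split=> [/andP [/eqP -> /eqP ->]|[-> ->]]; rewrite ?eqxx.
Qed.

Lemma primitive_F n v : v \in primitive n -> iter n.+1 F v = 0.
Proof.
move=> /primitiveP [Ev Hv]; have [->|v0] := eqVneq v 0.
  exact: iter_act0.
have [m [/eqP nm Fm]] := primitive_weight v0 Ev Hv.
by move: nm; rewrite eqr_nat => /eqP ->.
Qed.

Lemma primitive_P n v : v \in primitive n -> P v \in primitive n.+1.
Proof.
move=> /primitiveP [Ev Hv]; apply/primitiveP; split; first by rewrite act_ep Ev linear0.
by rewrite act_hp Hv linearZ -[n.+1]addn1 natrD scalerDl scale1r.
Qed.

(** E Q v = P v and E F P v = H P v = (c+1) P v, which fixes the coefficient of Q v. The weight c is
    arbitrary so that c = 0 is covered, where no lower space exists. *)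
Lemma E_lower c v : E v = 0 -> H v = c *: v -> E ((c + 1) *: Q v - F (P v)) = 0.
Proof.
move=> Ev Hv; rewrite linearB linearZ /= act_eq Ev linear0 add0r act_ef act_ep Ev !linear0 add0r.
by rewrite act_hp Hv linearZ /= scalerDl scale1r subrr.
Qed.

Lemma H_lower c b v : H v = c *: v -> H (b *: Q v - F (P v)) = (c - 1) *: (b *: Q v - F (P v)).
Proof.
move=> Hv; rewrite linearB linearZ /= act_hq act_hf act_hp Hv !linearD /= !linearZ /=.
apply: v2r_inj; apply/rowP => j; rewrite !(linearD, linearN, linearZ, linearB) /= !mxE; ring.
Qed.

Definition lower n : 'End(X) := n.+2%:R *: linfun Q - (linfun F \o linfun P)%VF.

Lemma lowerE n v : lower n v = n.+2%:R *: Q v - F (P v).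
Proof. by rewrite /lower add_lfunE opp_lfunE scale_lfunE comp_lfunE !lfunE. Qed.

Lemma primitive_lower n v : v \in primitive n.+1 -> lower n v \in primitive n.
Proof.
move=> /primitiveP [Ev Hv]; rewrite lowerE; apply/primitiveP; split.
  by rewrite -[n.+2]addn1 natrD E_lower.
by rewrite (H_lower _ Hv) -[n.+1]addn1 natrD addrK.
Qed.

(** The difference would be a highest weight vector of weight -1, and highest weights are natural
    numbers. *)
Lemma primitive0_lower v : v \in primitive 0 -> Q v = F (P v).
Proof.
move=> /primitiveP [Ev Hv]; apply/eqP; rewrite -subr_eq0; apply: contraT => v0.
have Ew := E_lower Ev Hv; have := H_lower (0%:R + 1) Hv.
rewrite add0r in Ew *; rewrite scale1r in Ew *.
move=> /(primitive_weight v0 Ew) [n [/eqP]].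
by rewrite subr_eq addrC eq_sym -[1]/(1%:R) -natrD eqr_nat.
Qed.

Hypothesis act_z : forall v, Z v = 0.

Definition prim_space n : vectType K := subvs_of (primitive n).
Definition prim_a n : 'Hom(prim_space n, prim_space n.+1) :=
  linfun (vsproj (primitive n.+1) \o P \o vsval).
Definition prim_b n : 'Hom(prim_space n.+1, prim_space n) :=
  linfun (vsproj (primitive n) \o lower n \o vsval).

Lemma prim_aE n (v : prim_space n) : vsval (prim_a n v) = P (vsval v).
Proof. by rewrite lfunE /= vsprojK // primitive_P // subvsP. Qed.
Lemma prim_bE n (v : prim_space n.+1) :
  vsval (prim_b n v) = n.+2%:R *: Q (vsval v) - F (P (vsval v)).
Proof. by rewrite lfunE /= vsprojK ?primitive_lower ?subvsP // lowerE. Qed.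

(** In weight 0, F P v = Q v, so F P P v = P F P v + Q P v = 2 Q P v, and 2 is the coefficient of Q
    in [prim_b 0]. *)
Lemma prim_rel0 : (prim_b 0 \o prim_a 0)%VF = 0.
Proof.
apply/lfunP => v; apply: subvs_inj.
rewrite comp_lfunE zero_lfunE prim_bE prim_aE /=.
rewrite [F (P (P _))]act_fp -(primitive0_lower (subvsP v)) act_pq act_z addr0.
by rewrite scaler_nat mulr2n subrr.
Qed.

(** Moving F past P costs one Q P, which is exactly the gap between the coefficients n+2 and n+3 of
    Q at consecutive levels. *)
Lemma prim_rel n : (prim_a n \o prim_b n)%VF = (prim_b n.+1 \o prim_a n.+1)%VF.
Proof.
apply/lfunP => v; apply: subvs_inj; rewrite 2!comp_lfunE.
rewrite (prim_aE (prim_b n v)) (prim_bE v) (prim_bE (prim_a n.+1 v)) (prim_aE v).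
rewrite linearB linearZ /= act_pq act_z addr0 [F (P (P _))]act_fp opprD addrA addrAC.
by congr (_ - _); rewrite -[n.+3%:R]natr1 [in RHS]scalerDl scale1r addrK.
Qed.

Definition prim_rep : Qrep K := QRep prim_rel0 prim_rel.

Lemma prim_rep_finite : finite_set [set i | \dim {: prim_rep i} <> 0%N].
Proof.
have [r rP] := finitely_many_eigenvalues H.
apply: (@sub_finite_set _ _ ((fun i : nat => i%:R : K) @^-1` [set` r])%classic).
  move=> i /= /eqP; rewrite dimv_eq0 => Vi.
  have v0 := vpick0 {: prim_rep i}; rewrite (negPf Vi) in v0.
  apply: (rP _ (vsval (vpick {: prim_rep i}))).
    by apply/negP => /eqP E0; move/negP: v0; apply; apply/eqP/subvs_inj.
  exact: ((primitiveP _ _).1 (subvsP (vpick {: prim_rep i}))).2.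
apply: finite_preimage; last exact: finite_seq.
by move=> i j _ _ /eqP; rewrite eqr_nat => /eqP.
Qed.
End RepTheory.

(** * Decomposition into strings generated by highest weight vectors *)

(** Induction on [N]: h - N kills the last summand of a sum of N+1 terms and multiplies the others
    by nonzero scalars. *)
Lemma sum_eigenvectors_eq0 (K : numClosedFieldType) (X : lmodType K) (h : {linear X -> X})
    N (w : nat -> X) :
  (forall i, h (w i) = i%:R *: w i) -> \sum_(i < N) w i = 0 ->
  forall i, (i < N)%N -> w i = 0.
Proof.
elim: N w => // N IH w hw sum0.
have w0 i : (i < N)%N -> w i = 0.
  move=> iN; have : (i%:R - N%:R) *: w i = 0.
    apply: (IH (fun i => (i%:R - N%:R) *: w i)) => // [j|].
      by rewrite linearZ /= hw !scalerA mulrC.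
    have -> : \sum_(i < N) (i%:R - N%:R) *: w i =
        h (\sum_(i < N.+1) w i) - N%:R *: \sum_(i < N.+1) w i.
      rewrite linear_sum scaler_sumr -sumrB big_ord_recr /= hw subrr addr0.
      by apply: eq_bigr => j _; rewrite hw scalerBl.
    by rewrite sum0 linear0 scaler0 subrr.
  by move/eqP; rewrite scaler_eq0 subr_eq0 eqr_nat ltn_eqF // => /eqP.
move=> i; rewrite ltnS leq_eqVlt => /orP [/eqP ->|/w0 //].
by move: sum0; rewrite big_ord_recr /= big1 ?add0r // => j _; apply: w0.
Qed.

Section Assembly.
Variables (K : numClosedFieldType) (X : vectType K) (act : sbasis -> {linear X -> X}).
Hypothesis act_lie : forall x y v,
  act x (act y v) - act y (act x v) = \sum_z ((slisted K x y - slisted K y x) z : K) *: act z v.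
Hypothesis act_z : forall v, act sz v = 0.

Local Notation E := (act se).
Local Notation H := (act sh).
Local Notation F := (act sf).
Local Notation P := (act sp).
Local Notation Q := (act sq).

Let V := prim_rep act_lie act_z.

(* f^k applied to x^n is n! / (n-k)! x^(n-k) y^k, so this vector plays the part
   of the monomial x^(n-k) y^k in the string of a highest weight vector v. *)
Definition ladder_vector n k (v : X) : X :=
  ((n - k)`!%:R / n`!%:R) *: iter k F v.

Local Notation t := ladder_vector.

Lemma iterF_linear k : linear (iter k F).
Proof. by elim: k => [|k IH] c v w //=; rewrite IH linearP. Qed.

Lemma ladder_vector_linear n k : linear (t n k).
Proof. by move=> c v w; rewrite /t iterF_linear scalerDr !scalerA mulrC. Qed.

HB.instance Definition _ n k :=
  GRing.isLinear.Build K X X _ (t n k) (ladder_vector_linear n k).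

Lemma fact_neq0 n : n`!%:R != 0 :> K.
Proof. by rewrite pnatr_eq0 -lt0n fact_gt0. Qed.

Lemma ladder_vector0 n v : t n 0 v = v.
Proof. by rewrite /t subn0 divff ?fact_neq0 // scale1r. Qed.

Lemma ladder_coefS n k : (k < n)%N ->
  (n - k)`!%:R / n`!%:R = (n%:R - k%:R) * ((n - k.+1)`!%:R / n`!%:R) :> K.
Proof.
by move=> kn; rewrite mulrA -natrB 1?ltnW // -natrM -[(n - k)%N]prednK ?subn_gt0 // factS -subnS.
Qed.

Lemma iterF_out n k v : v \in primitive act n -> (n < k)%N -> iter k F v = 0.
Proof.
move=> vn nk; rewrite -(subnK nk) iterD (primitive_F act_lie vn); exact: iter_act0.
Qed.

Lemma ladder_F n k v : v \in primitive act n -> F (t n k v) = (n%:R - k%:R) *: t n k.+1 v.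
Proof.
move=> vn; rewrite /t linearZ /= scalerA.
have [nk|kn] := leqP n k.
  by rewrite [F _](iterF_out (k := k.+1) vn) // !scaler0.
by rewrite ladder_coefS.
Qed.

Lemma ladder_E0 n v : v \in primitive act n -> E (t n 0 v) = 0.
Proof. by rewrite ladder_vector0 => /primitiveP []. Qed.

(** The bound is sharp: at k = n the left side is 0, since F^(n+1) v = 0, while the end of the
    string is in general not. *)
Lemma ladder_E n k v : v \in primitive act n -> (k < n)%N ->
  E (t n k.+1 v) = k.+1%:R *: t n k v.
Proof.
move=> /primitiveP [Ev Hv] kn; rewrite /t linearZ /= -/(iter k.+1 F v).
rewrite (lower_raise act_lie k Hv) Ev iter_act0 addr0 !scalerA; congr (_ *: _).
by rewrite (ladder_coefS kn); ring.
Qed.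

Lemma ladder_H n k v : v \in primitive act n ->
  H (t n k v) = (n%:R - 2%:R * k%:R) *: t n k v.
Proof.
have hf w : H (F w) = F (H w) + (- 2%:R) *: F w by rewrite scaleNr act_hf.
move=> /primitiveP [_ Hv]; rewrite /t linearZ /= (ladder_weight hf k Hv) !scalerA.
by congr (_ *: _); ring.
Qed.

(** Each F that P passes leaves one Q, which commutes with the remaining F. At k = 0 the coefficient
    hides the value of [k.-1]. *)
Lemma P_iterF k v : P (iter k F v) = iter k F (P v) - k%:R *: iter k.-1 F (Q v).
Proof.
have Fq j w : iter j F (Q w) = Q (iter j F w).
  by elim: j => //= j ->; rewrite act_fq.
elim: k => [|k IH]; first by rewrite scale0r subr0.
have -> : P (iter k.+1 F v) = F (P (iter k F v)) - Q (iter k F v).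
  by rewrite (act_fp act_lie) /= addrK.
rewrite IH linearB linearZ /= -Fq -addrA -opprD -addn1 natrD scalerDl scale1r.
by case: k {IH} => //; rewrite !scale0r.
Qed.

Lemma model_down_primE n (v : V n.+1) :
  vsval (model_down V n v : V n) = - (n.+1%:R * n.+2%:R)^-1 *: (n.+2%:R *: Q (vsval v) - F (P (vsval v))).
Proof.
rewrite /model_down scale_lfunE -[LHS]/(_ *: vsval (prim_b act n v)).
by rewrite (prim_bE act_lie).
Qed.

Lemma ladder_P0 (v : V 0) : P (t 0 0 (vsval v)) = t 1 0 (vsval (qa V 0 v)).
Proof. by rewrite !ladder_vector0; symmetry; apply: (prim_aE act_lie). Qed.

(** This is p = x a + d/dy b' on the monomial x^(n+1-k) y^k. The vector Q v that [P_iterF] produces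
    does not lie in one string: (n+2) Q v is the sum of F P v, from the string of a v, and of b
    v. *)
Lemma ladder_P n k (v : V n.+1) : (k <= n.+1)%N ->
  P (t n.+1 k (vsval v)) =
  t n.+2 k (vsval (qa V n.+1 v)) + k%:R *: t n k.-1 (vsval (model_down V n v)).
Proof.
rewrite [vsval (qa V n.+1 v)](prim_aE act_lie).
case: k => [_|j]; first by rewrite !ladder_vector0 scale0r addr0.
rewrite ltnS => jn; rewrite model_down_primE /= [t n j _]linearZ /= [t n j _]linearB /= [t n j (_ *: _)]linearZ /=.
rewrite /t linearZ -/(iter j.+1 F (vsval v)) P_iterF /=.
rewrite -[iter j F (F (P _))]iterSr /= -/(iter j.+1 F (P (vsval v))).
rewrite !subSS subSn // !factS !natrM.
(* Both sides are now combinations of F^(j+1) P v and F^j Q v, and only the factorial coefficients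
   remain to be compared. *)
move: (iter j.+1 F _) (iter j F _) => a b.
have f0 := fact_neq0; have nz m : n%:R + m.+1%:R != 0 :> K by rewrite -natrD addnS pnatr_eq0.
have -> : (n - j).+1%:R = n%:R - j%:R + 1 :> K by rewrite -natr1 natrB.
apply: v2r_inj; apply/rowP => l; rewrite !(linearD, linearN, linearZ, linearB) /= !mxE.
field; apply/and3P; split; first exact: f0.
- by rewrite addrC; exact: (nz 1%N).
- by rewrite addrC; exact: (nz 0%N).
Qed.

Definition embed n k (v : V n) : X := t n k (vsval v).

Lemma embed_linear n k : linear (@embed n k).
Proof. by move=> c v w; exact: ladder_vector_linear. Qed.

HB.instance Definition _ n k :=
  GRing.isLinear.Build K (V n) X _ (@embed n k) (@embed_linear n k).

Let prim n (v : V n) : vsval v \in primitive act n := subvsP v.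

(** Here and in the next lemmas the scalar stays inside [embed], so that its argument is the very
    coefficient that the model operator produces. *)
Lemma embed_H n k (v : V n) : H (embed k v) = embed k ((n%:R - 2%:R * k%:R) *: v).
Proof. by rewrite [RHS]linearZ; exact: (ladder_H k (prim v)). Qed.

Lemma embed_F n k (v : V n) : F (embed k v) = embed k.+1 ((n%:R - k%:R) *: v).
Proof. by rewrite [RHS]linearZ; exact: (ladder_F k (prim v)). Qed.

Lemma embed_E0 n (v : V n) : E (embed 0 v) = 0.
Proof. exact: (ladder_E0 (prim v)). Qed.

Lemma embed_E n k (v : V n) : (k < n)%N -> E (embed k.+1 v) = embed k (k.+1%:R *: v).
Proof. by move=> kn; rewrite [RHS]linearZ; exact: (ladder_E (prim v) kn). Qed.

Lemma embed_P0 (v : V 0) : P (embed 0 v) = embed 0 (qa V 0 v).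
Proof. exact: ladder_P0. Qed.

Lemma embed_P n k (v : V n.+1) : (k <= n.+1)%N ->
  P (embed k v) = embed k (qa V n.+1 v) + embed k.-1 (k%:R *: model_down V n v).
Proof. by move=> kn; rewrite [embed k.-1 _]linearZ; apply: ladder_P. Qed.

(** * The comparison map from the model to the module *)

Section Theta.
Variable N : nat.
Hypothesis VN : forall n (v : V n), (N <= n)%N -> v = 0.

Definition theta (g : model V) : X :=
  \sum_(n < N) \sum_(k < n.+1) embed k (coef g n k).

Lemma theta_linear : linear theta.
Proof.
move=> c g g'; rewrite /theta scaler_sumr -big_split /=; apply: eq_bigr => n _.
rewrite scaler_sumr -big_split /=; apply: eq_bigr => k _.
by rewrite -linearP.
Qed.

HB.instance Definition _ := GRing.isLinear.Build K (model V) X _ theta theta_linear.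

Lemma theta_H g : theta (op_model sh g) = H (theta g).
Proof.
rewrite /theta linear_sum; apply: eq_bigr => n _; rewrite linear_sum.
by apply: eq_bigr => k _; rewrite embed_H.
Qed.

Lemma theta_F g : theta (op_model sf g) = F (theta g).
Proof.
rewrite /theta linear_sum; apply: eq_bigr => n _; rewrite linear_sum.
(* F shifts k by one: the left sum has nothing at k = 0, and the end k = n of each string on the
   right is killed. *)
rewrite big_ord_recl [RHS]big_ord_recr /= embed_F subrr scale0r !linear0 addr0 add0r.
by apply: eq_bigr => k _; rewrite embed_F.
Qed.

Lemma theta_E g : theta (op_model se g) = E (theta g).
Proof.
rewrite /theta linear_sum; apply: eq_bigr => n _; rewrite linear_sum.
rewrite big_ord_recr [RHS]big_ord_recl /= embed_E0 add0r.
rewrite {2}/model_e coef_out // scaler0 linear0 addr0.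
by apply: eq_bigr => k _; rewrite embed_E.
Qed.

Lemma theta_P g : theta (op_model sp g) = P (theta g).
Proof.
rewrite /theta linear_sum.
transitivity (\sum_(n < N) \sum_(k < n.+1) embed k (model_up g n k)
  + \sum_(n < N) \sum_(k < n.+1) embed k (k.+1%:R *: model_down V n (g n.+1 k.+1))).
  rewrite -big_split; apply: eq_bigr => n _; rewrite -big_split; apply: eq_bigr => k _.
  exact: linearD.
(* The up part is reindexed from target level to source level. The extra top term that this creates
   lies in V_(M+1) = 0, and for the same reason the down part loses its level M. *)
case: N VN => [|M] VM; first by rewrite !big_ord0 addr0.
have -> : \sum_(n < M.+1) \sum_(k < n.+1) embed k (model_up g n k) =
    \sum_(n < M.+1) \sum_(k < n.+1) embed k (qa V n (coef g n k)).
  rewrite [RHS]big_ord_recr /= [X in _ = _ + X]big1 ?addr0 => [|k _]; last first.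
    by rewrite (VM _ (qa V M _)) // linear0.
  rewrite big_ord_recl big1 ?add0r => [|k _]; last exact: linear0.
  apply: eq_bigr => n _; rewrite big_ord_recr /= coef_out // !linear0 addr0.
  by apply: eq_bigr.
have -> : \sum_(n < M.+1) \sum_(k < n.+1) embed k (k.+1%:R *: model_down V n (coef g n.+1 k.+1)) =
    \sum_(n < M) \sum_(k < n.+1) embed k (k.+1%:R *: model_down V n (coef g n.+1 k.+1)).
  rewrite big_ord_recr /= [X in _ + X]big1 ?addr0 // => k _.
  by rewrite (VM _ (coef g M.+1 k.+1)) // linear0 scaler0 linear0.
rewrite big_ord_recl [RHS]big_ord_recl /= !big_ord1 embed_P0 -addrA; congr (_ + _).
rewrite -big_split; apply: eq_bigr => n _ /=.
transitivity (\sum_(k < n.+2) (embed k (qa V n.+1 (coef g n.+1 k)) +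
    embed k.-1 (k%:R *: model_down V n (coef g n.+1 k)))); last first.
  by rewrite linear_sum; apply: eq_bigr => k _; rewrite embed_P // -ltnS.
rewrite big_split; congr (_ + _).
by rewrite [RHS]big_ord_recl /= scale0r linear0 add0r.
Qed.

Lemma theta_delta n k (v : V n) : (k <= n)%N -> theta (delta k v) = embed k v.
Proof.
move=> kn; have [Nn|nN] := leqP N n.
  by rewrite (VN v Nn) [delta _ _]linear0 !linear0.
rewrite /theta (big_only1 (Ordinal nN)) // => [|m mn _]; last first.
  rewrite big1 // => l _; rewrite delta_off ?linear0 // xpair_eqE negb_and.
  by rewrite [nat_of_ord m == n](negPf mn).
have kn1 : (k < n.+1)%N by [].
rewrite (big_only1 (Ordinal kn1)) // => [|l lk _]; last first.
  rewrite delta_off ?linear0 // xpair_eqE negb_and.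
  by rewrite [nat_of_ord l == k](negPf lk) orbT.
by rewrite [coef _ _ _]delta_at.
Qed.

(** The scalar is (k+1)(k+2)...(k+i), nonzero in characteristic 0. *)
Lemma iter_model_e i k : exists2 c : K, c != 0 &
  forall (g : model V) n, coef (iter i (op_model se) g) n k = c *: coef g n (k + i)%N.
Proof.
elim: i k => [|i IH] k; first by exists 1; [exact: oner_neq0 | move=> g n; rewrite addn0 scale1r].
have [c c0 cE] := IH k.+1; exists (k.+1%:R * c); first by rewrite mulf_neq0 ?pnatr_eq0.
by move=> g n; rewrite iterS /= /model_e cE scalerA addSnnS.
Qed.

(** The coefficients vanish by descending induction on the power of y. If all powers beyond y^k are
    gone, e^k g consists of multiples of x^n alone; their images are eigenvectors of h for the
    distinct eigenvalues n, so a zero sum makes each of them 0. *)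
Lemma theta_inj g : theta g = 0 -> g = 0.
Proof.
move=> g0; suff tail j : forall n k, (N <= k + j)%N -> coef g n k = 0.
  by apply: model_ext => n k; apply: (tail N); rewrite leq_addl.
elim: j => [|j IH] n k; rewrite ?addn0 => Nk.
  have [nk|kn] := ltnP n k; first exact: coef_out.
  exact/VN/(leq_trans Nk).
have [?|lt] := leqP N (k + j); first exact: IH.
have {Nk lt} kE : N = (k + j.+1)%N by apply/eqP; rewrite eqn_leq Nk addnS lt.
have gk n' k' : (k < k')%N -> coef g n' k' = 0.
  by move=> kk'; apply: IH; rewrite kE addnS -addSn leq_add2r.
have [c c0 cE] := iter_model_e k 0.
have thk : theta (iter k (op_model se) g) = 0.
  by elim: (k) => //= i IHi; rewrite theta_E IHi linear0.
have : \sum_(m < N) embed 0 (coef (iter k (op_model se) g) m 0%N) = 0.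
  rewrite -[RHS]thk; apply: eq_bigr => m _; rewrite [RHS]big_ord_recl [X in _ + X]big1 ?addr0 // => l _.
  have [d d0 dE] := iter_model_e k (lift ord0 l).
  by rewrite dE gk ?scaler0 ?linear0 // lift0 addSn ltnS leq_addl.
move/(sum_eigenvectors_eq0 (h := H) (w := fun m => embed 0 (coef (iter k (op_model se) g) m 0%N))) => /(_ _) w0.
have [Nn|nN] := leqP N n; first exact: VN.
have /w0 : forall i, H (embed 0 (coef (iter k (op_model se) g) i 0%N)) =
    i%:R *: embed 0 (coef (iter k (op_model se) g) i 0%N).
  by move=> i; rewrite embed_H mulr0 subr0 linearZ.
move=> /(_ n nN); rewrite cE /embed ladder_vector0 add0n => /eqP.
rewrite -[0]/(vsval (0 : V n)) (inj_eq subvs_inj) scaler_eq0 (negPf c0) => /eqP.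
exact.
Qed.

(* Surjectivity: a weight vector u outside the image with E u and F^(j+1) u in the
   image, F^j u not, has weight j; some w in the image has the same weight and
   E w = E u, so u - w is a highest weight vector, hence in the image. *)
Definition theta_image : set X := [set v | exists g, theta g = v]%classic.
Local Notation I := theta_image.

Lemma theta_image_lin c v w : I v -> I w -> I (c *: v + w).
Proof. by move=> [g <-] [g' <-]; exists (c *: g + g'); rewrite linearP. Qed.
Lemma theta_image0 : I 0.
Proof. by exists 0; rewrite linear0. Qed.
Lemma theta_imageZ c v : I v -> I (c *: v).
Proof. by move=> Iv; rewrite -[_ *: _]addr0; apply: theta_image_lin => //; apply: theta_image0. Qed.
Lemma theta_imageB v w : I v -> I w -> I (v - w).
Proof. by move=> Iv Iw; rewrite addrC -scaleN1r; apply: theta_image_lin. Qed.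
Lemma theta_imageF k v : I v -> I (iter k F v).
Proof. by move=> Iv; elim: k => //= k [g <-]; exists (op_model sf g); apply: theta_F. Qed.

Lemma theta_primitive m v : v \in primitive act m -> I v.
Proof.
move=> vm; exists (delta 0 (vsproj (primitive act m) v : V m)).
by rewrite theta_delta // /embed ladder_vector0 vsprojK.
Qed.

(** Since e is x d/dy, the equation e w = g is solved in the model by integrating in y. Injectivity
    makes g homogeneous of weight m+2, so w is supported on n = m + 2k; as m is a natural number
    this gives k <= n, and w is an element of the model. *)
Lemma theta_lift (m : nat) u : I (E u) -> H u = m%:R *: u ->
  exists2 w, I w & E w = E u /\ H w = m%:R *: w.
Proof.
move=> [g gE] Hu.
have gw : op_model sh g = m.+2%:R *: g.
  apply/eqP; rewrite -subr_eq0; apply/eqP/theta_inj.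
  rewrite linearB linearZ /= theta_H gE act_he // Hu linearZ /= -scalerDl -scalerBl.
  by rewrite -[m.+2]addn2 natrD subrr scale0r.
have gsupp n k : coef g n k != 0 -> n = (m + 2 * k.+1)%N.
  move=> g0; have /eqP := congr1 (fun f => coef f n k) gw.
  rewrite -subr_eq0 /= /model_h -[m.+2%:R *: _]/(m.+2%:R *: coef g n k) -scalerBl.
  rewrite scaler_eq0 (negPf g0) orbF subr_eq add0r subr_eq -natrM -natrD eqr_nat => /eqP ->.
  by rewrite mulnS addnA addn2 addSn addnC.
pose w n k : V n :=
  if k is k'.+1 then if n == (m + 2 * k)%N then k%:R^-1 *: coef g n k' else 0 else 0.
have w_out n k : (n < k)%N -> w n k = 0.
  case: k => // k nk; rewrite /w; case: eqP => // nE; move: nk.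
  by rewrite nE ltnNge mul2n -addnn addnA leq_addl.
exists (theta (Model w_out)); first by exists (Model w_out).
split.
  rewrite -theta_E -gE; congr theta; apply: model_ext => n k.
  rewrite /= /model_e /w; case: eqP => [_|nE].
    by rewrite scalerA divff ?scale1r // pnatr_eq0.
  by rewrite scaler0; apply/esym/eqP; apply: contraT => /gsupp.
rewrite -theta_H -linearZ; congr theta; apply: model_ext => n k.
rewrite /= /model_h -[m%:R *: _]/(m%:R *: w n k).
case: k => [|k]; rewrite /w ?scaler0 //; case: eqP => [->|_]; rewrite ?scaler0 //.
by rewrite natrD natrM addrK.
Qed.

Hypothesis act_diag : forall v, exists (T : Type) (s : seq T) (w : T -> X) (c : T -> K),
  (forall i, H (w i) = c i *: w i) /\ v = \sum_(i <- s) w i.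

Lemma theta_surj v : I v.
Proof.
have [T [s [w [c [Hw ->]]]]] := act_diag v.
elim/big_rec: _ => [|i x _ Ix]; first exact: theta_image0.
rewrite -[w i]scale1r; apply: theta_image_lin => //.
move: (w i) (c i) (Hw i) => {Hw} {}v {c w i x Ix s T} c Hv.
apply: contrapT => nIv.
have nI0 u : ~ I u -> u != 0 by move=> nI; apply/eqP => u0; apply: nI; rewrite u0; apply: theta_image0.
(* u is the last E^j v outside the image. *)
have [u [b [nIu Hu IEu]]] : exists u b, [/\ ~ I u, H u = b *: u & I (E u)].
  have he x : H (E x) = E (H x) + 2%:R *: E x by exact: act_he.
  have N2 : 2%:R != 0 :> K by rewrite pnatr_eq0.
  have [i _ Ei] := ladder_top N2 he (nI0 _ nIv) Hv.
  have exi : exists i, `[< I (iter i E v) >].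
    by exists i.+1; apply/asboolP; rewrite /= Ei; apply: theta_image0.
  case: (ex_minnP exi) => [[|j] /asboolP Ij minj] //.
  exists (iter j E v), (c + j%:R * 2%:R); split=> //; last exact: ladder_weight.
  by move=> /asboolP /minj; rewrite ltnn.
have [m bm] : exists m : nat, b = m%:R.
  have hf x : H (F x) = F (H x) + (- 2%:R) *: F x by rewrite scaleNr act_hf.
  have N2 : - 2%:R != 0 :> K by rewrite oppr_eq0 pnatr_eq0.
  have [i _ Fi] := ladder_top N2 hf (nI0 _ nIu) Hu.
  have exi : exists i, `[< I (iter i F u) >].
    by exists i.+1; apply/asboolP; rewrite /= Fi; apply: theta_image0.
  case: (ex_minnP exi) => [[|j] /asboolP Ij minj] //.
  exists j; apply/eqP; rewrite -subr_eq0; apply: contraT => bj.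
  have : I (iter j F u).
    (* [lower_raise] solved for F^j u, which is possible when b differs from j. *)
    have -> : iter j F u = (j.+1%:R * (b - j%:R))^-1 *:
        (E (iter j.+1 F u) - iter j.+1 F (E u)).
      rewrite (lower_raise act_lie j Hu) addrK scalerA mulVf ?scale1r //.
      by rewrite mulf_neq0 ?pnatr_eq0.
    apply/theta_imageZ/theta_imageB; last exact: theta_imageF.
    by case: Ij => g <-; exists (op_model se g); apply: theta_E.
  by move=> /asboolP /minj; rewrite ltnn.
rewrite bm in Hu; have [w Iw [Ew Hw]] := theta_lift IEu Hu.
apply: nIu; rewrite -[u](subrK w) -[u - w]scale1r; apply: theta_image_lin => //.
apply: (@theta_primitive m); apply/primitiveP; split; rewrite linearB.
  by rewrite Ew subrr.
by rewrite Hu Hw scalerBr.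
Qed.
End Theta.
End Assembly.

(** * The two functors *)

Section UnderlyingRepresentation.
Variables (K : numClosedFieldType) (M : lmodType (Us K)).
Hypothesis fd : finite_dim [set: Defs.restrict M].

Local Notation X := (fdvect fd).

Definition mod_act_fun (x : sbasis) (v : X) : X := ub K x *: (v : M).

Lemma mod_act_linear x : linear (mod_act_fun x).
Proof.
move=> c v w; rewrite /mod_act_fun.
rewrite -[c *: v + w]/(c%:A *: (v : M) + w) -[RHS]/(c%:A *: (ub K x *: (v : M)) + ub K x *: (w : M)).
by rewrite scalerDr !scalerA mulr_algl mulr_algr.
Qed.

HB.instance Definition _ x :=
  GRing.isLinear.Build K X X _ (mod_act_fun x) (mod_act_linear x).

Definition mod_act (x : sbasis) : {linear X -> X} := mod_act_fun x.

Lemma mod_act_lie x y v :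
  mod_act x (mod_act y v) - mod_act y (mod_act x v) =
  \sum_z ((slisted K x y - slisted K y x) z : K) *: mod_act z v.
Proof.
rewrite -[LHS]/(ub K x *: (ub K y *: (v : M)) - ub K y *: (ub K x *: (v : M))).
rewrite !scalerA -scalerBl -ugen_lie lie_svec; set a := (slisted K x y - _); rewrite {1}[a]sum_svec.
pose s : {linear schrodinger K -> Us K} := HB.pack (@ugen K (schrodinger K))
  (GRing.isLinear.Build _ _ _ _ (@ugen K (schrodinger K)) (@ugen_linear _ _)).
rewrite -[ugen _]/(s _) linear_sum scaler_suml; apply: eq_bigr => z _.
rewrite linearZ -[RHS]/(((a z : K)%:A : Us K) *: (ub K z *: (v : M))).
by rewrite scalerA mulr_algl.
Qed.

Hypothesis wt : weight_module M.

Lemma mod_act_z v : mod_act sz v = 0.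
Proof.
have [spn _] := wt; have [s [w [_ ww ->]]] := spn v.
rewrite linear_sum big1 // => i _; have [Hw Zw] := ww i.
have [->|w0] := eqVneq (w i : X) 0; first exact: linear0.
rewrite -[LHS]/(ub K sz *: w i) Zw.
by rewrite (central_weight0 mod_act_lie w0 Hw Zw) !scale0r.
Qed.

Lemma mod_act_diag (v : X) :
  exists (T : Type) (s : seq T) (w : T -> X) (c : T -> K),
    (forall i, mod_act sh (w i) = c i *: w i) /\ v = \sum_(i <- s) w i.
Proof.
have [spn _] := wt; have [s [w [_ ww vE]]] := spn v.
by exists (K * K)%type, s, w, fst; split=> // i; have [] := ww i.
Qed.

Definition mod_rep : Qrep K := prim_rep mod_act_lie mod_act_z.

Lemma mod_aE n (v : mod_rep n) :
  vsval (qa mod_rep n v) = ub K sp *: (vsval v : M) :> M.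
Proof. exact: (prim_aE mod_act_lie). Qed.

Lemma mod_bE n (v : mod_rep n.+1) : vsval (qb mod_rep n v) =
  (n.+2%:R%:A : Us K) *: (ub K sq *: (vsval v : M)) - ub K sf *: (ub K sp *: (vsval v : M)) :> M.
Proof. exact: (prim_bE mod_act_lie). Qed.

Definition mod_bound : nat :=
  sval (cid (finite_support_bound (prim_rep_finite mod_act_lie mod_act_z))).

Lemma mod_boundP n (v : mod_rep n) : (mod_bound <= n)%N -> v = 0.
Proof. by rewrite /mod_bound; case: cid => N /=; apply. Qed.

End UnderlyingRepresentation.

(** * Functoriality of the highest weight spaces *)

Section PrimitiveMap.
Variables (K : numClosedFieldType) (M N : lmodType (Us K)).
Variables (fdM : finite_dim [set: Defs.restrict M]) (fdN : finite_dim [set: Defs.restrict N]).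
Variables (wtM : weight_module M) (wtN : weight_module N) (phi : {linear M -> N}).

Lemma prim_map_in n v :
  v \in primitive (mod_act fdM) n -> (phi v : fdvect fdN) \in primitive (mod_act fdN) n.
Proof.
move=> /primitiveP [Ev Hv]; apply/primitiveP; split.
  by rewrite -[LHS]/(ub K se *: phi v) -linearZ [_ *: _]Ev linear0.
rewrite -[LHS]/(ub K sh *: phi v) -linearZ [_ *: _]Hv.
exact: (linearZ_LR phi (n%:R%:A : Us K) v).
Qed.

Definition prim_map_fun n (v : mod_rep fdM wtM n) : mod_rep fdN wtN n :=
  vsproj (primitive (mod_act fdN) n) (phi (vsval v)).

Lemma prim_map_funE n (v : mod_rep fdM wtM n) :
  vsval (prim_map_fun v) = phi (vsval v).
Proof. by rewrite vsprojK // prim_map_in // subvsP. Qed.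

Lemma prim_map_linear n : linear (@prim_map_fun n).
Proof.
move=> c v w; apply: subvs_inj; rewrite prim_map_funE.
rewrite -[RHS]/((c%:A : Us K) *: (vsval (prim_map_fun v) : N) + vsval (prim_map_fun w)).
rewrite !prim_map_funE -linearP; congr (phi _).
Qed.

HB.instance Definition _ n := GRing.isLinear.Build K (mod_rep fdM wtM n)
  (mod_rep fdN wtN n) _ (@prim_map_fun n) (@prim_map_linear n).

Definition prim_map n : 'Hom(mod_rep fdM wtM n, mod_rep fdN wtN n) :=
  linfun (@prim_map_fun n).

Lemma prim_mapE n (v : mod_rep fdM wtM n) : vsval (prim_map n v) = phi (vsval v).
Proof. by rewrite lfunE prim_map_funE. Qed.

Lemma prim_map_a n : (prim_map n.+1 \o qa (mod_rep fdM wtM) n)%VF =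
  (qa (mod_rep fdN wtN) n \o prim_map n)%VF.
Proof.
apply/lfunP => v; apply: etrans (comp_lfunE _ _ _) (etrans _ (esym (comp_lfunE _ _ _))).
apply: subvs_inj.
apply: etrans (prim_mapE _) _.
 apply: etrans _ (esym (mod_aE _)).
by rewrite mod_aE linearZ prim_mapE.
Qed.

Lemma prim_map_b n : (prim_map n \o qb (mod_rep fdM wtM) n)%VF =
  (qb (mod_rep fdN wtN) n \o prim_map n.+1)%VF.
Proof.
apply/lfunP => v; apply: etrans (comp_lfunE _ _ _) (etrans _ (esym (comp_lfunE _ _ _))).
apply: subvs_inj.
apply: etrans (prim_mapE _) _.
 apply: etrans _ (esym (mod_bE _)).
by rewrite mod_bE linearB !linearZ prim_mapE.
Qed.

Definition prim_hom : Qhom (mod_rep fdM wtM) (mod_rep fdN wtN) :=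
  QHom prim_map_a prim_map_b.
End PrimitiveMap.

Lemma prim_hom_id (K : numClosedFieldType) (M : lmodType (Us K))
    (fd : finite_dim [set: Defs.restrict M]) (wt : weight_module M) :
  prim_hom fd fd wt wt (lid M) = qid (mod_rep fd wt).
Proof.
apply: qhom_inj => n; apply/lfunP => v; apply: subvs_inj.
by rewrite prim_mapE [in RHS]id_lfunE.
Qed.

Lemma prim_hom_comp (K : numClosedFieldType) (L M N : lmodType (Us K))
    (fdL : finite_dim [set: Defs.restrict L]) (fdM : finite_dim [set: Defs.restrict M])
    (fdN : finite_dim [set: Defs.restrict N]) (wtL : weight_module L)
    (wtM : weight_module M) (wtN : weight_module N) (f : {linear M -> N})
    (g : {linear L -> M}) :
  prim_hom fdL fdN wtL wtN (lcomp f g) =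
  qcomp (prim_hom fdM fdN wtM wtN f) (prim_hom fdL fdM wtL wtM g).
Proof.
apply: qhom_inj => n; apply/lfunP => v; apply: subvs_inj.
have E : vsval (prim_map fdL fdN wtL wtN (lcomp f g) n v) =
    vsval (prim_map fdM fdN wtM wtN f n (prim_map fdL fdM wtL wtM g n v)).
  by rewrite !prim_mapE.
rewrite [X in _ = vsval X]comp_lfunE; exact: E.
Qed.

Section UsLinear.
Variables (K : fieldType) (M N : lmodType (Us K)).
Variables (phi : Defs.restrict M -> Defs.restrict N) (phi_lin : linear phi).
Hypothesis phi_eq : forall x, equivariant phi (ub K x).

Definition Us_linear_fun : M -> N := phi.

Lemma Us_linear_funP : linear Us_linear_fun.
Proof.
move=> u v w; have phiD : {morph phi : a b / a + b}.
  by move=> a b; have := phi_lin 1 a b; rewrite !scale1r.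
by rewrite -(equivariant_Us phi_lin phi_eq u v); exact: phiD.
Qed.

HB.instance Definition _ :=
  GRing.isLinear.Build (Us K) M N _ Us_linear_fun Us_linear_funP.

Definition Us_linear : {linear M -> N} := Us_linear_fun.
End UsLinear.

Section UsGenerators.
Variables (K : fieldType) (M N : lmodType (Us K)).
Variables (phi : Defs.restrict M -> Defs.restrict N) (phi_lin : linear phi).

Lemma ub_lie x y w : slisted K x y - slisted K y x = svec K w ->
  ub K w = ub K x * ub K y - ub K y * ub K x.
Proof. by move=> E; rewrite /ub -E -lie_svec; apply: ugen_lie. Qed.

(* The Lie algebra is generated by e, f and p. *)
Lemma equivariant_efp :
  equivariant phi (ub K se) -> equivariant phi (ub K sf) -> equivariant phi (ub K sp) ->
  forall x, equivariant phi (ub K x).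
Proof.
move=> He Hf Hp.
have br x y w : slisted K x y - slisted K y x = svec K w ->
    equivariant phi (ub K x) -> equivariant phi (ub K y) -> equivariant phi (ub K w).
  by move=> /ub_lie -> Hx Hy; apply: equivariantB => //; apply: equivariantM.
have Hq : equivariant phi (ub K sq) by apply: (br sf sp) => //; rewrite /= subr0.
case=> //; first by apply: (br se sf) => //; rewrite /= subr0.
by apply: (br sp sq) => //; rewrite /= subr0.
Qed.
End UsGenerators.

Lemma linear_inverse (A : pzRingType) (M N : lmodType A) (f : {linear M -> N}) :
  (forall v, f v = 0 -> v = 0) -> (forall w, exists v, f v = w) ->
  exists g : {linear N -> M}, cancel f g /\ cancel g f.
Proof.
move=> f_inj f_surj; have [g gK] := choice f_surj.
have inj : injective f.
  by move=> u v uv; apply/eqP; rewrite -subr_eq0; apply/eqP/f_inj; rewrite linearB /= uv subrr.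
have fK : cancel f g by move=> v; apply: inj; rewrite gK.
have g_lin : linear g by move=> c u v; apply: inj; rewrite gK linearP !gK.
pose gl : {linear N -> M} := HB.pack g (GRing.isLinear.Build _ _ _ _ g g_lin).
by exists gl.
Qed.

(** * Functoriality of the polynomial model *)

Section ModelMap.
Variables (K : numClosedFieldType) (V W : Qrep K) (phi : Qhom V W).

Lemma model_map_out (g : model V) n k : (n < k)%N -> phi n (coef g n k) = 0.
Proof. by move=> nk; rewrite coef_out ?linear0. Qed.
Definition model_map_fun (g : model V) : model W := Model (@model_map_out g).

Lemma qhom_aE n v : phi n.+1 (qa V n v) = qa W n (phi n v).
Proof. by have /lfunP /(_ v) := qhom_a phi n; rewrite !comp_lfunE. Qed.
Lemma qhom_bE n v : phi n (qb V n v) = qb W n (phi n.+1 v).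
Proof. by have /lfunP /(_ v) := qhom_b phi n; rewrite !comp_lfunE. Qed.

Lemma model_map_linear :
  linear (model_map_fun : Defs.restrict (model_module V) -> Defs.restrict (model_module W)).
Proof.
move=> c f g; rewrite [X in model_map_fun (X + _)]model_module_scalar.
rewrite [X in _ = X + _]model_module_scalar; apply: model_ext => n k.
exact: linearP.
Qed.

Lemma model_map_op x g : model_map_fun (op_model x g) = op_model x (model_map_fun g).
Proof.
have down_phi n v : phi n (model_down V n v) = model_down W n (phi n.+1 v).
  by rewrite /model_down !scale_lfunE linearZ /= qhom_bE.
have up_phi n k : phi n (model_up g n k) = model_up (model_map_fun g) n k.
  by case: n => [|n]; [exact: linear0 | exact: qhom_aE].
apply: model_ext => n k; case: x => /=.
- by rewrite /model_e linearZ.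
- by rewrite /model_h linearZ.
- by case: k => [|k]; rewrite /model_f ?linear0 // linearZ.
- by rewrite /model_p linearD linearZ /= up_phi down_phi.
- by rewrite /model_q linearB linearZ /= down_phi; case: k => [|k]; rewrite ?up_phi ?linear0.
- exact: linear0.
Qed.

Lemma model_map_equivariant x : equivariant
  (model_map_fun : Defs.restrict (model_module V) -> Defs.restrict (model_module W)) (ub K x).
Proof. by move=> g; rewrite !model_moduleE; apply: model_map_op. Qed.

Definition model_map : {linear model_module V -> model_module W} :=
  Us_linear model_map_linear model_map_equivariant.
End ModelMap.

Section Functors.
Variable K : numClosedFieldType.

Section OfQuiver.
Variable V : Qinf_fmod K.

Let V_bound : exists N, forall n (v : sval V n), (N <= n)%N -> v = 0 :=
  finite_support_bound (svalP V).

Lemma model_object_fd : finite_dim [set: Defs.restrict (model_module (sval V))].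
Proof. by have [N VN] := V_bound; exact: (model_finite_dim VN). Qed.

Lemma model_object_O : in_category_O (model_module (sval V)).
Proof.
apply: finite_dim_in_category_O; first exact: model_object_fd.
by have [N VN] := V_bound; exact: (model_weight VN).
Qed.

Definition model_object : category_Of K :=
  exist _ (exist _ (model_module (sval V)) model_object_O) model_object_fd.
End OfQuiver.

Definition model_functor : functor (Qinf_fmod K) (category_Of K).
Proof.
refine (@Functor (Qinf_fmod K) (category_Of K) model_object
  (fun V W phi => @model_map K (sval V) (sval W) phi) _ _).
- by move=> V; apply: linear_inj => g; apply: model_ext => n k; exact: id_lfunE.
- by move=> U V W f g; apply: linear_inj => h; apply: model_ext => n k; exact: comp_lfunE.
Defined.

Section OfModule.
Variable M : category_Of K.

Definition obj_module : lmodType (Us K) := sval (sval M).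
Definition obj_fd : finite_dim [set: Defs.restrict obj_module] := svalP M.
Lemma obj_weight : weight_module obj_module.
Proof. by have [] := svalP (sval M). Qed.

Definition prim_object : Qinf_fmod K :=
  exist _ (mod_rep obj_fd obj_weight)
    (prim_rep_finite (@mod_act_lie _ _ obj_fd) (@mod_act_z _ _ obj_fd obj_weight)).
End OfModule.

Definition prim_functor : functor (category_Of K) (Qinf_fmod K).
Proof.
refine (@Functor (category_Of K) (Qinf_fmod K) prim_object
  (fun M N phi => prim_hom (obj_fd M) (obj_fd N) (obj_weight M) (obj_weight N) phi) _ _).
- by move=> M; apply: prim_hom_id.
- by move=> L M N f g; apply: prim_hom_comp.
Defined.
End Functors.

(** * The equivalence *)

Section ThetaIso.
Variables (K : numClosedFieldType) (M : lmodType (Us K)).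
Variables (fd : finite_dim [set: Defs.restrict M]) (wt : weight_module M).

Local Notation V := (mod_rep fd wt).

Definition mod_theta_fun (g : Defs.restrict (model_module V)) : Defs.restrict M :=
  theta (mod_bound fd wt) (g : model V).

Lemma mod_theta_linear : linear mod_theta_fun.
Proof.
move=> c g h; rewrite [X in mod_theta_fun (X + _)]model_module_scalar.
exact: (@theta_linear K (fdvect fd) _ _ _ (mod_bound fd wt) c (g : model V) (h : model V)).
Qed.

Lemma mod_theta_equivariant : forall x, equivariant mod_theta_fun (ub K x).
Proof.
have VN := @mod_boundP _ _ fd wt.
apply: equivariant_efp; first exact: mod_theta_linear.
- by move=> g; rewrite model_moduleE; exact: (theta_E (mod_bound fd wt) g).
- by move=> g; rewrite model_moduleE; exact: (theta_F (mod_bound fd wt) g).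
- by move=> g; rewrite model_moduleE; exact: (theta_P VN g).
Qed.

Definition mod_theta : {linear model_module V -> M} :=
  Us_linear mod_theta_linear mod_theta_equivariant.

Lemma mod_theta_inverse :
  exists f : {linear M -> model_module V}, cancel mod_theta f /\ cancel f mod_theta.
Proof.
apply: linear_inverse => [g g0|v].
  exact: (theta_inj (@mod_boundP _ _ fd wt) g0).
exact: (theta_surj (@mod_boundP _ _ fd wt) (mod_act_diag wt) v).
Qed.

Definition mod_theta_inv : {linear M -> model_module V} := sval (cid mod_theta_inverse).

Lemma mod_thetaK : cancel mod_theta mod_theta_inv.
Proof. by rewrite /mod_theta_inv; case: cid => f []. Qed.
Lemma mod_theta_invK : cancel mod_theta_inv mod_theta.
Proof. by rewrite /mod_theta_inv; case: cid => f []. Qed.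

(** Levels beyond the chosen bound contribute nothing. Naturality needs this, because source and
    target come with different bounds and are compared at a common one. *)
Lemma mod_theta_bound N (g : model V) : (mod_bound fd wt <= N)%N ->
  mod_theta g = theta N g.
Proof.
move=> /subnK <-; elim: (N - _)%N => //= d ->; rewrite addSn /theta big_ord_recr /=.
rewrite [X in _ = _ + X]big1 ?addr0 // => k _.
by rewrite (mod_boundP (coef g _ k)) ?leq_addl // linear0.
Qed.
End ThetaIso.

Section ThetaNatural.
Variables (K : numClosedFieldType) (M N : lmodType (Us K)).
Variables (fdM : finite_dim [set: Defs.restrict M]) (fdN : finite_dim [set: Defs.restrict N]).
Variables (wtM : weight_module M) (wtN : weight_module N) (phi : {linear M -> N}).

Definition mod_map_fun (v : fdvect fdM) : fdvect fdN := phi v.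
Lemma mod_map_linear : linear mod_map_fun.
Proof. by move=> c v w; exact: (linearP phi (c%:A) v w). Qed.
HB.instance Definition _ := GRing.isLinear.Build K (fdvect fdM) (fdvect fdN) _
  mod_map_fun mod_map_linear.

Lemma mod_map_embed n k (v : mod_rep fdM wtM n) :
  mod_map_fun (embed k v) = embed k (prim_map fdM fdN wtM wtN phi n v).
Proof.
rewrite /embed /ladder_vector linearZ prim_mapE; congr (_ *: _).
by elim: k => //= k <-; exact: linearZ.
Qed.

Lemma mod_theta_natural g :
  mod_theta fdN wtN (model_map (prim_hom fdM fdN wtM wtN phi) g) = phi (mod_theta fdM wtM g).
Proof.
pose B := maxn (mod_bound fdM wtM) (mod_bound fdN wtN).
rewrite (mod_theta_bound (N := B)) ?leq_maxr //.
rewrite (mod_theta_bound (N := B)) ?leq_maxl //.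
rewrite -[RHS]/(mod_map_fun _) /theta linear_sum; apply: eq_bigr => n _.
rewrite linear_sum; apply: eq_bigr => k _.
exact: (esym (mod_map_embed k (coef g n k))).
Qed.
End ThetaNatural.

(** * Recovering a quiver representation from the highest weight vectors of its model *)

Section Eta.
Variables (K : numClosedFieldType) (V : Qrep K).
Variables (fd : finite_dim [set: Defs.restrict (model_module V)]).
Variables (wt : weight_module (model_module V)).

Local Notation W := (mod_rep fd wt).

(** The highest weight vectors of weight n are the x^n v with v in V_n: [E g = 0] kills every
    coefficient involving y, because the factors k+1 are nonzero, and among the powers of x the
    h-weight singles out level n. *)
Lemma primitive_modelP n (g : model V) :
  (g : fdvect fd) \in primitive (mod_act fd) n <-> g = delta 0 (coef g n 0%N).
Proof.
have -> : ((g : fdvect fd) \in primitive (mod_act fd) n) <->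
    op_model se g = 0 /\ op_model sh g = n%:R *: g.
  split.
    move=> /primitiveP [Eg Hg]; rewrite -[op_model se g]model_moduleE.
    rewrite -[op_model sh g]model_moduleE; split; first exact: Eg.
    by rewrite -[RHS]model_module_scalar; exact: Hg.
  move=> [Eg Hg]; apply/primitiveP; split.
    by rewrite -[LHS]/(ub K se *: (g : model_module V)) model_moduleE.
  rewrite -[LHS]/(ub K sh *: (g : model_module V)) model_moduleE Hg.
  by rewrite -[LHS]model_module_scalar.
have at_n m k : (m, k) != (n, 0)%N -> coef (delta 0 (coef g n 0%N)) m k = 0.
  exact: delta_off.
split=> [[Eg Hg]|gE].
  apply: model_ext => m k; have [[-> ->]|neq] := eqVneq (m, k) (n, 0%N).
    by rewrite [RHS]delta_at.
  rewrite at_n //; case: k neq => [|k] neq.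
    have /eqP := congr1 (fun f => coef f m 0%N) Hg.
    rewrite /= /model_h mulr0 subr0 -[n%:R *: _]/(n%:R *: coef g m 0%N) -subr_eq0 -scalerBl.
    rewrite scaler_eq0 subr_eq0 eqr_nat => /orP [/eqP mn|/eqP //].
    by rewrite mn eqxx in neq.
  have /eqP := congr1 (fun f => coef f m k) Eg.
  by rewrite /= /model_e scaler_eq0 pnatr_eq0 => /eqP.
split; apply: model_ext => m k.
  by rewrite /= /model_e gE at_n ?scaler0 // xpair_eqE andbF.
rewrite /= /model_h -[n%:R *: _]/(n%:R *: coef g m k).
have [[-> ->]|neq] := eqVneq (m, k) (n, 0%N); first by rewrite mulr0 subr0.
by rewrite gE at_n // !scaler0.
Qed.

Lemma model_fdvectP c (g h : fdvect fd) :
  c *: g + h = c *: (g : model V) + (h : model V) :> model V.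
Proof. exact: (congr1 (fun g' : model_module V => g' + h) (model_module_scalar c g)). Qed.

Definition eta_fun n (u : W n) : V n := coef (vsval u) n 0%N.
Lemma eta_linear n : linear (@eta_fun n).
Proof.
move=> c u v.
exact: (congr1 (fun g : model V => coef g n 0%N)
  (etrans (vsval_is_linear c u v) (model_fdvectP c (vsval u) (vsval v)))).
Qed.
HB.instance Definition _ n := GRing.isLinear.Build K (W n) (V n) _ (@eta_fun n) (@eta_linear n).

Definition eta_inv_fun n (v : V n) : W n := vsproj (primitive (mod_act fd) n) (delta 0 v).

Lemma eta_inv_funE n (v : V n) : vsval (eta_inv_fun v) = delta 0 v.
Proof. by rewrite vsprojK //; apply/primitive_modelP; rewrite delta_at. Qed.

Lemma eta_inv_funK n (v : V n) : eta_fun (eta_inv_fun v) = v.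
Proof. by rewrite /eta_fun eta_inv_funE [LHS]delta_at. Qed.

Lemma eta_funK n (u : W n) : eta_inv_fun (eta_fun u) = u.
Proof. by apply: subvs_inj; rewrite eta_inv_funE -((primitive_modelP _ _).1 (subvsP u)). Qed.

Lemma eta_inv_linear n : linear (@eta_inv_fun n).
Proof.
move=> c u v; apply: (can_inj (@eta_funK n)); rewrite eta_inv_funK.
by apply: esym; apply: etrans (eta_linear c _ _) _; rewrite !eta_inv_funK.
Qed.
HB.instance Definition _ n :=
  GRing.isLinear.Build K (V n) (W n) _ (@eta_inv_fun n) (@eta_inv_linear n).

Lemma eta_a n (u : W n) : eta_fun (qa W n u) = qa V n (eta_fun u).
Proof.
have -> : eta_fun (qa W n u) = coef (op_model sp (vsval u)) n.+1 0%N.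
  exact: (congr1 (fun g : model V => coef g n.+1 0%N)
    (etrans (mod_aE u) (model_moduleE sp (vsval u)))).
rewrite /= /model_p /=.
have -> : coef (vsval u) n.+2 1%N = 0.
  by rewrite ((primitive_modelP _ _).1 (subvsP u)) delta_off // xpair_eqE andbF.
by rewrite linear0 scaler0 addr0.
Qed.

(** Here the normalisation of [model_down] is used up: f has no output at y^0, so the coefficient of
    x^n in (n+2) q - f p applied to x^(n+1) v is -(n+2)(n+1) b'v, that is, b v. *)
Lemma eta_b n (u : W n.+1) : eta_fun (qb W n u) = qb V n (eta_fun u).
Proof.
have E (g : model_module V) :
    (n.+2%:R%:A : Us K) *: (ub K sq *: g) - ub K sf *: (ub K sp *: g) =
    n.+2%:R *: op_model sq g - op_model sf (op_model sp g) :> model V.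
  by rewrite !model_moduleE model_module_scalar.
have -> : eta_fun (qb W n u) =
    coef (n.+2%:R *: op_model sq (vsval u) - op_model sf (op_model sp (vsval u))) n 0%N.
  exact: (congr1 (fun g : model V => coef g n 0%N) (etrans (mod_bE u) (E (vsval u)))).
rewrite -[LHS]/(coef_at n 0 _) linearB linearZ /coef_at /= /model_q subr0 !sub0r.
rewrite subr0 /model_down scale_lfunE scalerN -scaleNr !scalerA.
rewrite -[RHS]scale1r; congr (_ *: _).
have nz m : n%:R + m.+1%:R != 0 :> K by rewrite -natrD addnS pnatr_eq0.
field; apply/andP; split; rewrite addrC; [exact: (nz 1%N) | exact: (nz 0%N)].
Qed.

Definition eta n : 'Hom(W n, V n) := linfun (@eta_fun n).
Definition eta_inv n : 'Hom(V n, W n) := linfun (@eta_inv_fun n).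

Lemma etaE n u : eta n u = eta_fun u. Proof. exact: lfunE. Qed.
Lemma eta_invE n v : eta_inv n v = eta_inv_fun v. Proof. exact: lfunE. Qed.

Lemma eta_hom_a n : (eta n.+1 \o qa W n)%VF = (qa V n \o eta n)%VF.
Proof.
apply/lfunP => u; apply: etrans (comp_lfunE _ _ _) (etrans _ (esym (comp_lfunE _ _ _))).
by apply: etrans (etaE _) (etrans (eta_a u) _); rewrite etaE.
Qed.
Lemma eta_hom_b n : (eta n \o qb W n)%VF = (qb V n \o eta n.+1)%VF.
Proof.
apply/lfunP => u; apply: etrans (comp_lfunE _ _ _) (etrans _ (esym (comp_lfunE _ _ _))).
by apply: etrans (etaE _) (etrans (eta_b u) _); rewrite etaE.
Qed.
Lemma eta_inv_hom_a n : (eta_inv n.+1 \o qa V n)%VF = (qa W n \o eta_inv n)%VF.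
Proof.
apply/lfunP => v; apply: etrans (comp_lfunE _ _ _) (etrans _ (esym (comp_lfunE _ _ _))).
apply: etrans (eta_invE _) _; rewrite eta_invE; apply: (can_inj (@eta_funK n.+1)).
by rewrite eta_inv_funK; apply: esym; apply: etrans (eta_a _) _; rewrite eta_inv_funK.
Qed.
Lemma eta_inv_hom_b n : (eta_inv n \o qb V n)%VF = (qb W n \o eta_inv n.+1)%VF.
Proof.
apply/lfunP => v; apply: etrans (comp_lfunE _ _ _) (etrans _ (esym (comp_lfunE _ _ _))).
apply: etrans (eta_invE _) _; rewrite eta_invE; apply: (can_inj (@eta_funK n)).
by rewrite eta_inv_funK; apply: esym; apply: etrans (eta_b _) _; rewrite eta_inv_funK.
Qed.

Definition eta_hom : Qhom W V := QHom eta_hom_a eta_hom_b.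
Definition eta_inv_hom : Qhom V W := QHom eta_inv_hom_a eta_inv_hom_b.

Lemma eta_homK : qcomp eta_inv_hom eta_hom = qid W.
Proof.
apply: qhom_inj => n; apply/lfunP => u.
apply: etrans (comp_lfunE _ _ _) (etrans _ (esym (id_lfunE _))).
by apply: etrans (eta_invE _) _; rewrite [eta_hom n u]etaE eta_funK.
Qed.
Lemma eta_inv_homK : qcomp eta_hom eta_inv_hom = qid V.
Proof.
apply: qhom_inj => n; apply/lfunP => u.
apply: etrans (comp_lfunE _ _ _) (etrans _ (esym (id_lfunE _))).
by apply: etrans (etaE _) _; rewrite [eta_inv_hom n u]eta_invE eta_inv_funK.
Qed.
End Eta.

Lemma eta_natural (K : numClosedFieldType) (V W : Qrep K)
    (fdV : finite_dim [set: Defs.restrict (model_module V)])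
    (fdW : finite_dim [set: Defs.restrict (model_module W)])
    (wtV : weight_module (model_module V)) (wtW : weight_module (model_module W))
    (phi : Qhom V W) :
  qcomp (eta_hom fdW wtW) (prim_hom fdV fdW wtV wtW (model_map phi)) =
  qcomp phi (eta_hom fdV wtV).
Proof.
apply: qhom_inj => n; apply/lfunP => u.
apply: etrans (comp_lfunE _ _ _) (etrans _ (esym (comp_lfunE _ _ _))).
apply: etrans (etaE _) _; rewrite [eta_hom fdV wtV n u]etaE.
exact: (congr1 (fun g : model W => coef g n 0%N) (prim_mapE fdW wtW (model_map phi) u)).
Qed.

Section Equivalence.
Variable K : numClosedFieldType.

Definition theta_iso :
  nat_iso (functor_comp (model_functor K) (prim_functor K)) (functor_id (category_Of K)).
Proof.
refine (@NatIso (category_Of K) (category_Of K)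
  (functor_comp (model_functor K) (prim_functor K)) (functor_id (category_Of K))
  (fun M => mod_theta (obj_fd M) (obj_weight M))
  (fun M => mod_theta_inv (obj_fd M) (obj_weight M)) _ _ _).
- by move=> M; apply: linear_inj => g; apply: mod_thetaK.
- by move=> M; apply: linear_inj => v; apply: mod_theta_invK.
- by move=> M N phi; apply: linear_inj => g; apply: mod_theta_natural.
Qed.

Definition eta_iso :
  nat_iso (functor_comp (prim_functor K) (model_functor K)) (functor_id (Qinf_fmod K)).
Proof.
refine (@NatIso (Qinf_fmod K) (Qinf_fmod K)
  (functor_comp (prim_functor K) (model_functor K)) (functor_id (Qinf_fmod K))
  (fun V => eta_hom (obj_fd (model_object V)) (obj_weight (model_object V)))
  (fun V => eta_inv_hom (obj_fd (model_object V)) (obj_weight (model_object V))) _ _ _).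
- by move=> V; apply: eta_homK.
- by move=> V; apply: eta_inv_homK.
- by move=> V W phi; apply: eta_natural.
Qed.

Lemma category_Of_equivalent : equivalent (category_Of K) (Qinf_fmod K).
Proof.
exists (prim_functor K), (model_functor K); split; constructor.
  exact: theta_iso.
exact: eta_iso.
Qed.
End Equivalence.

Theorem theorem13 (R : realType) :
  equivalent (category_Of (complex R)) (Qinf_fmod (complex R)).
Proof. exact: category_Of_equivalent. Qed.
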